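(* For integers $n,d,k\ge1$ let $T_{n,d,k}=\mathbb{C}[x_1,\ldots,x_n]/(x_1^d,\ldots,x_n^d)^k$. Then, for $k\ge1$: (i) the algebra $T_{4,2,k}$ has the weak Lefschetz property if and only if $k\le3$; (ii) the algebra $T_{4,3,k}$ has the weak Lefschetz property if and only if $k\le2$; (iii) the algebra $T_{4,4,k}$ has the weak Lefschetz property if and only if $k\le2$; (iv) the algebra $T_{5,2,k}$ has the weak Lefschetz property if and only if $k\le7$.
   Context: A standard graded algebra $A=\bigoplus_i A_i$ over $\mathbb{C}$ has the weak Lefschetz property (WLP) if there exists a linear form $L\in A_1$ such that for every degree $i$ the multiplication map $\times L\colon A_i\to A_{i+1}$ has maximal rank, i.e. is injective or surjective. Here $(x_1^d,\ldots,x_n^d)^k$ is the $k$-th power of the ideal generated by $x_1^d,\dots,x_n^d$. *)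

(* Defs.v *)
From HB Require Import structures.
From mathcomp Require Import all_boot all_algebra ring_quotient.
From mathcomp Require Import boolp classical_sets functions reals.
From mathcomp Require Import complex.
From mathcomp.multinomials Require Import mpoly.

Set Implicit Arguments.
Unset Strict Implicit.
Unset Printing Implicit Defensive.

Import GRing.Theory.
Local Open Scope classical_set_scope.
Local Open Scope ring_scope.
Local Open Scope quotient_scope.

Definition ideal_gen (A : comNzRingType) (S : set A) : set A :=
  [set f | exists (m : nat) (a g : 'I_m -> A),
     (forall j, S (g j)) /\ f = \sum_(j < m) a j * g j].

Definition ideal_exp (A : comNzRingType) (I : set A) (k : nat) : set A :=
  ideal_gen [set f | exists g : 'I_k -> A,
     (forall j, I (g j)) /\ f = \prod_(j < k) g j].

Section IdealQuotientAlgebra.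
Variables (K : comNzRingType) (A : comAlgType K) (I : idealr A).

Definition ideal_quot_scale (c : K) (x : {ideal_quot I}) : {ideal_quot I} :=
  \pi_{ideal_quot I} c%:A * x.

Fact ideal_quot_scalerA c e x :
  ideal_quot_scale c (ideal_quot_scale e x) = ideal_quot_scale (c * e) x.
Proof.
by rewrite /ideal_quot_scale mulrA -rmorphM /= -scalerAl mul1r scalerA.
Qed.

Fact ideal_quot_scale1r : left_id 1 ideal_quot_scale.
Proof. by move=> x; rewrite /ideal_quot_scale scale1r rmorph1 mul1r. Qed.

Fact ideal_quot_scalerDr : right_distributive ideal_quot_scale +%R.
Proof. by move=> c x y; rewrite /ideal_quot_scale mulrDr. Qed.

Fact ideal_quot_scalerDl x : {morph ideal_quot_scale^~ x : c e / c + e}.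
Proof. by move=> c e; rewrite /ideal_quot_scale scalerDl rmorphD mulrDl. Qed.

HB.instance Definition _ := GRing.Zmodule_isLmodule.Build K {ideal_quot I}
  ideal_quot_scalerA ideal_quot_scale1r ideal_quot_scalerDr
  ideal_quot_scalerDl.

Fact ideal_quot_scalerAl (c : K) (x y : {ideal_quot I}) :
  c *: (x * y) = c *: x * y.
Proof. by rewrite /GRing.scale /= /ideal_quot_scale mulrA. Qed.

HB.instance Definition _ :=
  GRing.Lmodule_isLalgebra.Build K {ideal_quot I} ideal_quot_scalerAl.

Fact ideal_quot_scalerAr (c : K) (x y : {ideal_quot I}) :
  c *: (x * y) = x * (c *: y).
Proof. by rewrite /GRing.scale /= /ideal_quot_scale mulrCA. Qed.

HB.instance Definition _ :=
  GRing.Lalgebra_isAlgebra.Build K {ideal_quot I} ideal_quot_scalerAr.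

End IdealQuotientAlgebra.

(* [gr i] is the set of homogeneous elements of degree [i] of [A]. *)
Definition weak_lefschetz (K : fieldType) (A : comAlgType K)
    (gr : nat -> set A) : Prop :=
  exists2 L : A, gr 1 L &
    forall i : nat, set_inj (gr i) ( *%R L) \/
                    set_surj (gr i) (gr i.+1) ( *%R L).

Section PowerIdeal.
Variables (K : fieldType) (n d k : nat).
Local Notation P := {mpoly K[n]}.

Definition pure_powers : set P := [set f | exists i : 'I_n, f = 'X_i ^+ d].

Definition power_ideal : set P := ideal_exp (ideal_gen pure_powers) k.

Hypotheses (d_gt0 : (0 < d)%N) (k_gt0 : (0 < k)%N).

(* The positivity proofs are only there so that the ideal is proper, which
   the library requires of the ideals that it takes quotients by. *)
Definition power_idealb of (0 < d)%N & (0 < k)%N : {pred P} :=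
  fun f => `[< power_ideal f >].

Fact power_ideal_closed : idealr_closed (power_idealb d_gt0 k_gt0).
Proof.
have gen0 (S : set P) h : (forall g, S g -> g.@[fun=> 0] = 0) ->
    ideal_gen S h -> h.@[fun=> 0] = 0.
  move=> S0 [m [a [g [Sg ->]]]]; rewrite rmorph_sum big1 // => j _.
  by rewrite rmorphM /= (S0 _ (Sg j)) mulr0.
have ev0 f : power_ideal f -> f.@[fun=> 0] = 0.
  move=> If; apply: (gen0 _ _ _ If) => _ [g [Ig ->]]; rewrite rmorph_prod /=.
  rewrite (bigD1 (Ordinal k_gt0)) //= (gen0 _ _ _ (Ig _)) ?mul0r //.
  by move=> _ [i ->]; rewrite rmorphXn /= mevalXU expr0n gtn_eqF.
split.
- apply/asboolP; exists 0, (fun=> 0), (fun=> 0).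
  by split; [case | rewrite big_ord0].
- apply/asboolP => /ev0 /eqP; rewrite rmorph1.
  by rewrite oner_eq0.
move=> a f g /asboolP [p [b [u [Su ->]]]] /asboolP [q [c [v [Sv ->]]]].
apply/asboolP; exists (p + q)%N.
exists (fun j : 'I_(p + q) =>
  match fintype.split j with inl x => a * b x | inr y => c y end).
exists (fun j : 'I_(p + q) =>
  match fintype.split j with inl x => u x | inr y => v y end).
split=> [j|]; first by case: (fintype.split j).
rewrite big_split_ord mulr_sumr /=; congr (_ + _); apply: eq_bigr => j _.
  by rewrite (unsplitK (inl j)) mulrA.
by rewrite (unsplitK (inr j)).
Qed.

HB.instance Definition _ :=
  isIdealr.Build P (power_idealb d_gt0 k_gt0) power_ideal_closed.

Definition power_quot : comAlgType K :=
  {ideal_quot (power_idealb d_gt0 k_gt0)}.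

Definition power_quot_gr (i : nat) : set power_quot :=
  [set \pi_{ideal_quot (power_idealb d_gt0 k_gt0)} f | f in
     [set f : P | f \is i.-homog]].

End PowerIdeal.

Arguments power_quot : clear implicits.
Arguments power_quot_gr : clear implicits.

(* Main.v *)
Require Import Defs.
From Stdlib Require Import BinInt.
From mathcomp Require Import all_boot all_order all_algebra ring_quotient.
From mathcomp Require Import boolp classical_sets functions.
From mathcomp Require Import reals complex.
From mathcomp Require Import ssrZ zify ring.
From mathcomp.multinomials Require Import mpoly.

(* The standard monomials x^a, those with sum_i floor(a_i / d) < k, form a basis
   of T_{n,d,k}. The socle lives in a single degree, so injectivity of a linear
   form passes to lower degrees, while surjectivity passes to higher ones;
   everything is decided near degree dk + d - 3.

   Surjectivity. On a plane s u + t v in the kernel of the linear form, with u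
   and v of disjoint supports, the ideal (x_i^d) restricts to (s^d, t^d); hence
   the map onto degree dk + d - 2 is never surjective. The map given by
   x_1 + ... + x_n onto the next degree is surjective as soon as it is so for
   k = 1, which is an explicit computation.

   Injectivity. A kernel element in degree dk + e - 1 is a relation, with
   coefficients of degree e, among the d-th powers of the variables modulo the
   linear form. For d = 2 and e = 0 the first one is the product of the
   2^(n-1) forms x_1 +- ... +- x_n, of degree 2^(n-2) in the squares, so kernel
   elements appear at k = 4 for n = 4 and at k = 8 for n = 5. For d = 3 and
   d = 4 the first relations in the critical degree appear at k = 3: there is
   none for k = 2, by elimination, and one for k = 3 is written down. Multiplying
   by x_1^d carries a kernel element from k to k + 1. *)

Set Implicit Arguments.
Unset Strict Implicit.
Unset Printing Implicit Defensive.

Import Order.TTheory GRing.Theory Num.Theory.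
Local Open Scope ring_scope.
Local Open Scope quotient_scope.
Local Open Scope complex_scope.

(** * Powers of the ideal as monomial ideals *)

Lemma leq_add_divn d a b : (a %/ d + b %/ d <= (a + b) %/ d)%N.
Proof.
case: (posnP d) => [->|d_gt0]; first by rewrite !divn0.
by rewrite leq_divRL // mulnDl leq_add // leq_divM.
Qed.

Section MonomialIdeal.
Variables (n d : nat).

(** For d > 0, the largest number of factors x_i^d, with repetition, whose product divides x^m; so
    x^m lies in the k-th power of (x_1^d, ..., x_n^d) exactly when [k <= level m]. *)
Definition level (m : 'X_{1..n}) : nat := \sum_i m i %/ d.

Lemma level_add m1 m2 : (level m1 + level m2 <= level (m1 + m2)%MM)%N.
Proof.
rewrite /level -big_split; apply: leq_sum => i _.
by rewrite mnmDE leq_add_divn.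
Qed.

Lemma level_le m1 m2 : (m1 <= m2)%MM -> (level m1 <= level m2)%N.
Proof. by move=> /mnm_lepP le_m; apply: leq_sum => i _; apply: leq_div2r. Qed.

Lemma level_addMn m i : (0 < d)%N -> level (m + U_(i) *+ d)%MM = (level m).+1.
Proof.
move=> d_gt0; rewrite /level (bigD1 i) //= [in RHS](bigD1 i) //=.
rewrite mnmDE mulmnE mnm1E eqxx mul1n divnDr // divnn d_gt0 addn1 addSn.
congr (_.+1); congr addn; apply: eq_bigr => j /negPf nji.
by rewrite mnmDE mulmnE mnm1E eq_sym nji mul0n addn0.
Qed.

Variable K : fieldType.
Implicit Types f g h : {mpoly K[n]}.

(** The power ideal is spanned by monomials, so membership is a condition on coefficients; k = 0
    gives the whole ring. *)
Definition in_pow (k : nat) f := forall m, (level m < k)%N -> f@_m = 0.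

Lemma in_pow0 f : in_pow 0 f. Proof. by []. Qed.

Lemma in_pow_zero k : in_pow k 0. Proof. by move=> m _; rewrite mcoeff0. Qed.

Lemma in_powD k f g : in_pow k f -> in_pow k g -> in_pow k (f + g).
Proof. by move=> If Ig m lt_m; rewrite mcoeffD If ?Ig ?addr0. Qed.

Lemma in_powN k f : in_pow k f -> in_pow k (- f).
Proof. by move=> If m lt_m; rewrite mcoeffN If ?oppr0. Qed.

Lemma in_powB k f g : in_pow k f -> in_pow k g -> in_pow k (f - g).
Proof. by move=> If Ig; apply: in_powD => //; apply: in_powN. Qed.

Lemma in_powM a b f g : in_pow a f -> in_pow b g -> in_pow (a + b) (f * g).
Proof.
move=> If Ig m lt_m; apply: memN_msupp_eq0; apply/negP => /msuppM_le.
case/allpairsP => -[m1 m2] /= [m1f m2g def_m].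
move: m1f m2g; rewrite !mcoeff_msupp => /eqP m1f /eqP m2g.
have a1 : (a <= level m1)%N by rewrite leqNgt; apply/negP => /If.
have b2 : (b <= level m2)%N by rewrite leqNgt; apply/negP => /Ig.
by move: lt_m; rewrite def_m ltnNge (leq_trans (leq_add a1 b2)) // level_add.
Qed.

Lemma in_powMl k f g : in_pow k g -> in_pow k (f * g).
Proof. by move=> Ig; have := in_powM (@in_pow0 f) Ig. Qed.

Lemma in_pow_sum k (I : Type) (r : seq I) (P : pred I) (F : I -> {mpoly K[n]}) :
  (forall i, P i -> in_pow k (F i)) -> in_pow k (\sum_(i <- r | P i) F i).
Proof.
move=> IF; elim/big_ind: _ => //; first exact: in_pow_zero.
by move=> f g; apply: in_powD.
Qed.

Lemma in_powZ k c f : in_pow k f -> in_pow k (c *: f).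
Proof. by move=> If m lt_m; rewrite mcoeffZ If ?mulr0. Qed.

Lemma in_powX k m : (k <= level m)%N -> in_pow k 'X_[m].
Proof.
move=> le_k m' lt_m'; rewrite mcoeffX; case: eqP => // def_m.
by move: lt_m'; rewrite -def_m ltnNge le_k.
Qed.

Lemma in_pow_var i : (0 < d)%N -> in_pow 1 ('X_i ^+ d).
Proof.
move=> d_gt0; rewrite mpolyXn; apply: in_powX.
by have := level_addMn 0 i d_gt0; rewrite add0m => ->.
Qed.

Lemma in_pow_prod k (g : 'I_k -> {mpoly K[n]}) :
  (forall j, in_pow 1 (g j)) -> in_pow k (\prod_(j < k) g j).
Proof.
elim: k g => [|k IH] g Ig; first exact: in_pow0.
by rewrite big_ord_recl; apply: (@in_powM 1 k) => //; apply: IH => j.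
Qed.

(** While the level is positive some exponent is at least d, and one factor x_i^d is split off. *)
Lemma powers_dvd_monomial k m : (0 < d)%N -> (k <= level m)%N ->
  exists (e : 'I_k -> 'I_n) (a : {mpoly K[n]}),
    'X_[m] = a * \prod_(j < k) 'X_(e j) ^+ d.
Proof.
move=> d_gt0; elim: k m => [|k IH] m le_k.
  by exists (fun j : 'I_0 => match j with Ordinal _ p => match notF p with end end),
    'X_[m]; rewrite big_ord0 mulr1.
have [i le_di] : exists i, (d <= m i)%N.
  apply/existsP; rewrite -[X in is_true X]negbK; apply/negP.
  rewrite negb_exists => /forallP lt_md.
  move: le_k; rewrite /level big1 // => i _.
  by rewrite divn_small // ltnNge lt_md.
have def_m : (m - U_(i) *+ d + U_(i) *+ d)%MM = m.
  apply: submK; apply/mnm_lepP => j; rewrite mulmnE mnm1E.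
  by case: eqP => [<-|_]; rewrite ?mul1n.
have [|e [a def_X]] := IH (m - U_(i) *+ d)%MM.
  by rewrite -ltnS -(level_addMn _ i d_gt0) def_m.
exists (fun j => if unlift ord0 j is Some j' then e j' else i), a.
rewrite -{1}def_m mpolyXD def_X big_ord_recl unlift_none -mulrA -mpolyXn.
congr (_ * _); rewrite mulrC; congr (_ * _).
by apply: eq_bigr => j _; rewrite liftK.
Qed.

Lemma power_idealP k f : (0 < d)%N -> (0 < k)%N ->
  power_ideal d k f <-> in_pow k f.
Proof.
move=> d_gt0 k_gt0; split.
  case=> p [a [g [Sg ->]]]; apply: in_pow_sum => j _; apply: in_powMl.
  have [u [Iu ->]] := Sg j; apply: in_pow_prod => l.
  have [q [b [v [Sv ->]]]] := Iu l; apply: in_pow_sum => s _; apply: in_powMl.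
  by have [i ->] := Sv s; apply: in_pow_var.
(* Closure of [power_idealb] under sums and multiples reduces the claim to single monomials. *)
move=> If; apply/asboolP; rewrite -[asbool _]/(f \in power_idealb d_gt0 k_gt0).
rewrite [f]mpolyE big_seq; apply: rpred_sum => m m_f.
rewrite -mul_mpolyC; apply: idealMr; apply/asboolP.
have [|e [a ->]] := @powers_dvd_monomial k m d_gt0.
  by rewrite leqNgt; apply/negP => /If /eqP; rewrite mcoeff_eq0 m_f.
exists 1%N, (fun=> a), (fun=> \prod_(j < k) 'X_(e j) ^+ d).
split; last by rewrite big_ord1.
move=> _; exists (fun j => 'X_(e j) ^+ d); split=> // j.
exists 1%N, (fun=> 1), (fun=> 'X_(e j) ^+ d).
by split=> [_|]; [exists (e j) | rewrite big_ord1 mul1r].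
Qed.

End MonomialIdeal.

(** * Multiplication by a linear form *)

Section Multiplication.
Variables (n d : nat) (K : fieldType).
Implicit Types f g h : {mpoly K[n]}.

Definition lin (c : 'I_n -> K) : {mpoly K[n]} := \sum_i c i *: 'X_i.

(** [inj_at] and [surj_at] work on polynomial representatives and are indexed by the source degree;
    injectivity is triviality of the kernel. *)
Definition inj_at k c i := forall f,
  f \is i.-homog -> in_pow d k (lin c * f) -> in_pow d k f.

Definition surj_at k c i := forall h, h \is i.+1.-homog ->
  exists2 f, f \is i.-homog & in_pow d k (h - lin c * f).

Lemma lin_homog c : lin c \is 1.-homog.
Proof.
apply: rpred_sum => i _; apply: dhomogZ.
by rewrite dhomogX /= mdeg1.
Qed.

Lemma homog1_lin f : f \is 1.-homog -> f = lin (fun i => f@_U_(i)).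
Proof.
move=> fH; apply/mpolyP => m; rewrite /lin raddf_sum /=.
under eq_bigr do rewrite mcoeffZ mcoeffX.
have [/mdeg1P[i /eqP ->] | m_neq1] := boolP (mdeg m == 1%N).
  rewrite (bigD1 i) //= eqxx mulr1 big1 ?addr0 // => j /negPf nij.
  by rewrite eq_mnm1 nij mulr0.
rewrite (dhomog_nemf_coeff fH m_neq1) big1 // => i _.
by case: (_ =P m) m_neq1 => [<-|]; rewrite ?mdeg1 // mulr0.
Qed.

(** Subtraction of exponents is truncated, whence the separate case [m i == 0]. *)
Lemma mcoeff_lin c f m : (lin c * f)@_m =
  \sum_i (if m i == 0%N then 0 else c i * f@_(m - U_(i))%MM).
Proof.
rewrite /lin mulr_suml raddf_sum /=; apply: eq_bigr => i _.
rewrite -scalerAl mcoeffZ ['X_i * f]mulrC; case: (eqVneq (m i) 0%N) => [mi0|mi_neq0].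
  rewrite (_ : _@__ = 0) ?mulr0 //.
  apply: memN_msupp_eq0; apply/negP => /msuppM_le.
  case/allpairsP => -[m1 m2] /= [_ + def_m].
  rewrite msuppX inE => /eqP def_m2; move: mi0.
  by rewrite def_m def_m2 mnmDE mnm1E eqxx addn1.
have def_m : (m - U_(i) + U_(i))%MM = m by apply: submK; rewrite lep1mP.
by rewrite -{1}def_m addmC mcoeffMX.
Qed.

(** Every linear form is some [lin c], and differences of representatives of one degree are
    homogeneous, so the property can be read on polynomials. *)
Lemma weak_lefschetzP k (d_gt0 : (0 < d)%N) (k_gt0 : (0 < k)%N) :
  weak_lefschetz (power_quot_gr K n d k d_gt0 k_gt0) <->
  exists c, forall i, inj_at k c i \/ surj_at k c i.
Proof.
pose pi := \pi_{ideal_quot (@power_idealb K n d k d_gt0 k_gt0)}.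
have piE x y : (pi x = pi y) <->
    in_pow d k (x - y).
  rewrite -(power_idealP _ d_gt0 k_gt0); split=> [/eqP | Ixy].
    by rewrite -Quotient.idealrBE => /asboolP.
  by apply/eqP; rewrite -Quotient.idealrBE; apply/asboolP.
have injE l i : set_inj (power_quot_gr K n d k d_gt0 k_gt0 i)
      ( *%R (pi l)) <->
    forall f, f \is i.-homog -> in_pow d k (l * f) -> in_pow d k f.
  split=> [inj f fH Ilf | inj _ _ /set_mem[x xH <-] /set_mem[y yH <-]].
    rewrite -[f]subr0; apply/piE.
    apply: inj.
    - by apply/mem_set; exists f.
    - by apply/mem_set; exists 0; first exact: dhomog0.
    by rewrite -!rmorphM; apply/piE; rewrite mulr0 subr0.
  rewrite -!rmorphM => /piE; rewrite -mulrBr => Il; apply/piE.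
  by apply: inj => //; apply: rpredB.
have surjE l i : set_surj (power_quot_gr K n d k d_gt0 k_gt0 i)
      (power_quot_gr K n d k d_gt0 k_gt0 i.+1) ( *%R (pi l)) <->
    forall h, h \is i.+1.-homog ->
      exists2 f, f \is i.-homog & in_pow d k (h - l * f).
  split=> [surj h hH | surj _ [h hH <-]].
    have [|_ [f fH <-]] := surj (pi h); first by exists h.
    by rewrite -rmorphM => /piE Ih; exists f => //; rewrite -opprB; apply: in_powN.
  have [f fH /piE Ef] := surj h hH.
  by exists (pi f); [exists f | rewrite -rmorphM; exact/esym].
split=> [[_ [l lH <-] wl] | [c wl]].
  exists (fun i => l@_U_(i)) => i.
  by rewrite /inj_at /surj_at -homog1_lin //; case: (wl i) => [/injE|/surjE];
    [left|right].
exists (pi (lin c)); first by exists (lin c); first exact: lin_homog.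
by move=> i; case: (wl i) => [/injE|/surjE]; [left|right].
Qed.

End Multiplication.

(** * Propagation between degrees and powers *)

Section Propagation.
Variables (n d : nat) (K : fieldType).
Implicit Types (f g h : {mpoly K[n]}) (c : 'I_n -> K).

Lemma level_addU (m : 'X_{1..n}) j :
  (level d (m + U_(j))%MM + m j %/ d = level d m + (m j).+1 %/ d)%N.
Proof.
rewrite /level (bigD1 j) //= [in RHS](bigD1 j) //= mnmDE mnm1E eqxx addn1.
rewrite (eq_bigr (fun i => (m i %/ d)%N)) => [|i /negPf nij]; first by lia.
by rewrite mnmDE mnm1E eq_sym nij addn0.
Qed.

Lemma mcoeffXUM f i m : ('X_i * f)@_(m + U_(i))%MM = f@_m.
Proof. by rewrite mulrC addmC mcoeffMX. Qed.

Lemma homogXM j f i : f \is i.-homog -> 'X_j * f \is i.+1.-homog.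
Proof.
by move=> fH; rewrite -add1n; apply: dhomogM => //; rewrite dhomogX /= mdeg1.
Qed.

(* The socle of the quotient is concentrated in degree d(k-1) + n(d-1). *)
Lemma inj_at_pred k c i : (0 < n)%N -> (0 < d)%N ->
  (i < d * k.-1 + n * d.-1)%N -> inj_at d k c i.+1 -> inj_at d k c i.
Proof.
move=> n_gt0 d_gt0 lt_i inj f fH Ilf m lt_m; apply/eqP; apply: contraT => nz_fm.
(* By injectivity in degree i + 1, x_j f lies in the ideal, so x_j x^m has level at least k. *)
have lev j : (k <= level d (m + U_(j))%MM)%N.
  rewrite leqNgt; apply/negP => lt_mj; case/negP: nz_fm.
  rewrite -(mcoeffXUM f j) (inj ('X_j * f)) //; first exact: homogXM.
  by rewrite mulrCA; apply: in_powMl.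
(* Raising any exponent by one raises the level, so all exponents are -1 modulo d and the level is k
   - 1: m has the socle degree, which [lt_i] excludes. *)
have dvd_m j : ((m j).+1 %/ d = (m j %/ d).+1)%N /\ level d m = k.-1.
  have := lev j; have := level_addU m j; have := leq_divDl d (m j) 1.
  rewrite [(m j + 1)%N]addn1; case: (ltnP 1 d) => [d_gt1 | d_le1].
    by rewrite (divn_small d_gt1); lia.
  move: lt_m; have -> : d = 1%N by lia.
  by rewrite !divn1; lia.
have def_m j : m j = (m j %/ d * d + d.-1)%N.
  have := divn_eq (m j).+1 d; rewrite (dvd_m j).1 => def.
  have := ltn_pmod (m j).+1 d_gt0; have := ltn_pmod (m j) d_gt0.
  have := divn_eq (m j) d; lia.
have deg_m : mdeg m = i.
  apply/eqP; apply: contraT => /(dhomog_nemf_coeff fH) fm0.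
  by rewrite fm0 eqxx in nz_fm.
move: lt_i; rewrite -deg_m mdegE (eq_bigr _ (fun j _ => def_m j)) big_split /=.
rewrite sum_nat_const card_ord -big_distrl /= -[\sum_i _]/(level d m).
by rewrite (dvd_m (Ordinal n_gt0)).2 mulnC ltnn.
Qed.

Lemma inj_at_le k c i j : (0 < n)%N -> (0 < d)%N -> (i <= j)%N ->
  (j <= d * k.-1 + n * d.-1)%N -> inj_at d k c j -> inj_at d k c i.
Proof.
move=> n_gt0 d_gt0 /subnK <-; elim: (j - i)%N => // e IH le_j inj.
by apply: IH; [lia | apply: inj_at_pred].
Qed.

Lemma surj_at_monomials k c i :
  (forall m, mdeg m = i.+1 ->
     exists2 f, f \is i.-homog & in_pow d k ('X_[m] - lin c * f)) ->
  surj_at d k c i.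
Proof.
move=> surj h hH; rewrite [h]mpolyE big_seq.
elim/big_ind: _ => [|x y [f fH If] [g gH Ig]|m m_h].
- by exists 0; [exact: dhomog0 | rewrite mulr0 subr0; apply: in_pow_zero].
- exists (f + g); first exact: dhomogD.
  by rewrite mulrDr opprD addrACA; apply: in_powD.
have [f fH If] := surj m (dhomog_mf hH m_h).
exists (h@_m *: f); first exact: dhomogZ.
by rewrite -scalerAr -scalerBr; apply: in_powZ.
Qed.

(** A monomial of degree i + 2 is a variable times one of degree i + 1. *)
Lemma surj_at_succ k c i : surj_at d k c i -> surj_at d k c i.+1.
Proof.
move=> surj; apply: surj_at_monomials => m deg_m.
have [j mj_neq0] : exists j, m j != 0%N.
  apply/existsP; apply: contra_eqT deg_m; rewrite negb_exists => /forallP m0.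
  by rewrite mdegE big1 // => j _; apply/eqP; rewrite -[_ == _]negbK m0.
have def_m : (m - U_(j) + U_(j))%MM = m by apply: submK; rewrite lep1mP.
have [|f fH If] := surj 'X_[m - U_(j)].
  by rewrite dhomogX /=; have := congr1 mdeg def_m; rewrite mdegD mdeg1 deg_m; lia.
exists ('X_j * f); first exact: homogXM.
rewrite -def_m mpolyXD mulrC mulrCA -mulrBr; exact: in_powMl.
Qed.

Lemma surj_at_le k c i j : (i <= j)%N -> surj_at d k c i -> surj_at d k c j.
Proof.
by move=> /subnK <-; elim: (j - i)%N => // e IH surj; apply: surj_at_succ; apply: IH.
Qed.

(** Multiplication by x_i^d shifts the exponents and raises each level by exactly one. *)
Lemma in_pow_mulXd k i f : (0 < d)%N ->
  in_pow d k.+1 ('X_i ^+ d * f) <-> in_pow d k f.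
Proof.
move=> d_gt0; split=> If; last first.
  by rewrite -add1n; apply: in_powM => //; apply: in_pow_var.
move=> m lt_m; rewrite -(@mcoeffMX _ _ f (U_(i) *+ d)%MM m) addmC -mpolyXn mulrC.
by apply: If; rewrite level_addMn.
Qed.

Lemma inj_at_shift k c i : (0 < n)%N -> (0 < d)%N ->
  inj_at d k.+1 c (d + i) -> inj_at d k c i.
Proof.
move=> n_gt0 d_gt0 inj f fH Ilf; pose j := Ordinal n_gt0.
apply/(in_pow_mulXd _ j _ d_gt0); apply: inj.
  apply: dhomogM => //; rewrite -[X in X.-homog]mul1n; apply: dhomogMn.
  by rewrite dhomogX /= mdeg1.
by rewrite mulrCA; apply/in_pow_mulXd.
Qed.

(* If [lin (fun=> 1)] kills [g], the rescaling [g(c_1 x_1, ..., c_n x_n)] is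
   killed by [lin c]; when some [c_j] vanish, only its component of lowest
   degree in the corresponding variables is used. *)
Lemma inj_at_ones k c i :
  inj_at d k c i -> inj_at d k ((fun=> 1) : 'I_n -> K) i.
Proof.
move=> inj g gH Ig.
(* [w] is the degree in the variables with c_j = 0; [cm m] is the factor by which rescaling the
   others multiplies x^m. *)
pose w (m : 'X_{1..n}) := (\sum_(j | c j == 0%R) m j)%N.
pose cm (m : 'X_{1..n}) := \prod_(j | c j != 0) c j ^+ m j.
suff g0 e m : w m = e -> (level d m < k)%N -> g@_m = 0 by move=> m; apply: g0.
elim/ltn_ind: e m => e IH.
(* Induction covers the weights below e; [g'] is the rescaled standard part of weight e. *)
pose good m := (level d m < k)%N && (w m == e).
pose g' := \sum_(m <- msupp g | good m) (g@_m * cm m) *: 'X_[m].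
have g'E m : g'@_m = if good m then g@_m * cm m else 0.
  rewrite /g' raddf_sum /=; under eq_bigr do rewrite mcoeffZ mcoeffX.
  have [m_g | m_notg] := boolP (m \in msupp g); last first.
    rewrite big1_seq => [|m' /andP[_ m'_g]].
      by rewrite (memN_msupp_eq0 m_notg) mul0r if_same.
    by case: eqP m'_g m_notg => [-> ->|]; rewrite ?mulr0.
  rewrite -big_filter; case: ifP => good_m.
    rewrite (bigD1_seq m) ?filter_uniq ?msupp_uniq ?mem_filter ?good_m //=.
    rewrite eqxx mulr1 big1 ?addr0 // => m' /negPf nm'.
    by rewrite nm' mulr0.
  rewrite big1_seq // => m' /andP[_]; rewrite mem_filter => /andP[good_m' _].
  by case: eqP good_m' => [->|]; rewrite ?good_m ?mulr0.
have lt_sub (m : 'X_{1..n}) j : m j != 0%N -> (level d m < k)%N ->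
  (level d (m - U_(j))%MM < k)%N.
  move=> nz_mj; apply: leq_ltn_trans; apply: level_le; exact: lem_subr.
have w_sub (m : 'X_{1..n}) j : c j != 0 -> w (m - U_(j))%MM = w m.
  move=> nz_cj; apply: eq_bigr => l cl0; rewrite mnmBE mnm1E.
  by case: eqP => [jl|]; rewrite ?subn0 // -jl (negPf nz_cj) in cl0 *.
have Ig' : in_pow d k (lin c * g').
  move=> m lt_m; rewrite mcoeff_lin.
  (* [lin c] involves no variable counted by [w], so it preserves the weight. *)
  have [w_m | w_m] := eqVneq (w m) e; last first.
    rewrite big1 // => j _; case: eqP => // /eqP nz_mj; rewrite g'E.
    have [->|nz_cj] := eqVneq (c j) 0; first by rewrite mul0r.
    by rewrite /good w_sub // (negPf w_m) andbF mulr0.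
  have := Ig m lt_m; rewrite mcoeff_lin => /(congr1 (fun x => cm m * x)).
  rewrite mulr0 mulr_sumr => sum0; rewrite -[RHS]sum0; apply: eq_bigr => j _.
  case: eqP => [|/eqP nz_mj]; first by rewrite mulr0.
  have def_m : (m - U_(j) + U_(j))%MM = m by apply: submK; rewrite lep1mP.
  (* When c_j = 0, the exponent m - U_(j) has weight below e, and g vanishes there by induction. *)
  have [cj0|nz_cj] := eqVneq (c j) 0.
    rewrite (IH (w (m - U_(j))%MM)) ?lt_sub //; first by rewrite cj0 !(mulr0, mul0r).
    rewrite -w_m -[X in (_ < w X)%N]def_m /w [in X in (_ < X)%N](bigD1 j) ?cj0 //=.
    rewrite (bigD1 j) ?cj0 //= mnmDE mnm1E eqxx addn1 addSn ltnS leq_add2l.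
    by apply: leq_sum => l _; rewrite mnmDE leq_addr.
  rewrite g'E /good lt_sub //= w_sub // w_m eqxx.
  rewrite mul1r mulrCA [RHS]mulrC; congr (_ * _).
  rewrite -[in RHS]def_m /cm (bigD1 j) //= [in RHS](bigD1 j) //= mulrA.
  congr (_ * _); first by rewrite mnmDE mnm1E eqxx addn1 exprS.
  apply: eq_bigr => l /andP[_ /negPf nlj].
  by rewrite [in RHS]mnmDE mnm1E eq_sym nlj addn0.
have g'H : g' \is i.-homog.
  apply: rpred_sum => m _; have [m_g|/memN_msupp_eq0 ->] := boolP (m \in msupp g).
    by apply: dhomogZ; rewrite dhomogX /=; apply/eqP; apply: (dhomog_mf gH).
  by rewrite mul0r scale0r; exact: dhomog0.
move=> m w_m lt_m; have := inj g' g'H Ig' m lt_m.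
rewrite g'E /good lt_m w_m eqxx /= => /eqP; rewrite mulf_eq0 => /orP[/eqP //|].
by rewrite /cm prodf_seq_eq0 => /hasP[j _ /andP[nz_cj]];
  rewrite expf_eq0 (negPf nz_cj) andbF.
Qed.
End Propagation.

(** * Failure of surjectivity *)

Section SurjectivityFailure.
Variable K : fieldType.

Lemma exists_kernel_pair (x y : K) :
  exists a : bool -> K, x * a false + y * a true = 0 /\ exists b, a b != 0.
Proof.
have [->|nz_x] := eqVneq x 0.
  have [->|nz_y] := eqVneq y 0.
    by exists (fun=> 1); rewrite !mul0r addr0; split=> //; exists true;
      rewrite oner_eq0.
  exists (fun b => if b then 0 else y); split; first by rewrite mul0r mulr0 addr0.
  by exists false.
exists (fun b => if b then x else - y); split;
  first by rewrite mulrN [y * x]mulrC addNr.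
by exists true.
Qed.

Variables (n d k : nat) (c : 'I_n.+4 -> K).
Let o (j : nat) : 'I_n.+4 := inord j.

(* Two vectors with disjoint supports on which the linear form vanishes give a
   ring map to K[s, t] that kills it and sends each x_i^d to a multiple of s^d
   or t^d, while s^(dk - 1) t^(d - 1) is outside the ideal (s^d, t^d)^k. *)
Lemma not_surj_at i : (0 < d)%N -> (0 < k)%N -> (i.+1 = (d * k).-1 + d.-1)%N ->
  ~ surj_at d k c i.
Proof.
move=> d_gt0 k_gt0 def_i surj.
have [a [a0 [b1 nz_a]]] := exists_kernel_pair (c (o 0)) (c (o 1)).
have [b [b0 [b2 nz_b]]] := exists_kernel_pair (c (o 2)) (c (o 3)).
have oE j : (j < 4)%N -> o j = j :> nat by move=> lt_j; rewrite /o inordK //; lia.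
(* [v] puts the two kernel vectors on coordinates 0, 1 and 2, 3; [h] sends x_j to v_j s or v_j t,
   with s the outer and t the inner variable. *)
pose v (j : 'I_n.+4) : K :=
  if (j < 2)%N then a (j == 1%N :> nat)
  else if (j < 4)%N then b (j == 3 :> nat) else 0.
pose h (j : 'I_n.+4) : {poly {poly K}} :=
  (v j)%:P%:P * (if (j < 2)%N then 'X else 'X%:P).
pose f : {rmorphism K -> {poly {poly K}}} := polyC \o polyC.
pose wA (m : 'X_{1..n.+4}) := (\sum_(j < n.+4 | (j < 2)%N) m j)%N.
pose wB (m : 'X_{1..n.+4}) := (\sum_(j < n.+4 | ~~ (j < 2)%N) m j)%N.
have hX m : mmap f h 'X_[m] =
    (\prod_j v j ^+ m j)%:P%:P * ('X^(wA m) * 'X^(wB m)%:P).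
  rewrite mmapX /mmap1 (eq_bigr _ (fun j _ => exprMn _ _ _)).
  rewrite big_split /= !rmorph_prod /=; congr (_ * _).
    by apply: eq_bigr => j _; rewrite !rmorphXn.
  rewrite (bigID (fun j : 'I_n.+4 => (j < 2)%N)) /=; congr (_ * _).
    by rewrite /wA expr_sum; apply: eq_bigr => j ->.
  by rewrite /wB expr_sum rmorph_prod; apply: eq_bigr => j /negPf ->;
    rewrite rmorphXn.
have hlin : mmap f h (lin c) = 0.
  rewrite /lin raddf_sum /=; under eq_bigr do rewrite mmapZ mmapX mmap1U /h.
  rewrite !big_ord_recl /= big1 => [|j _]; last first.
    by rewrite /v /= !(mul0r, mulr0).
  have e0 : ord0 = o 0 by apply: val_inj; rewrite /= oE.
  have e1 : lift ord0 ord0 = o 1 by apply: val_inj; rewrite /= oE.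
  have e2 : lift ord0 (lift ord0 ord0) = o 2 by apply: val_inj; rewrite /= oE.
  have e3 : lift ord0 (lift ord0 (lift ord0 ord0)) = o 3.
    by apply: val_inj; rewrite /= oE.
  have lin2 (x y u w : K) (Z : {poly {poly K}}) :
      x%:P%:P * (u%:P%:P * Z) + y%:P%:P * (w%:P%:P * Z) = (x * u + y * w)%:P%:P * Z.
    by rewrite !mulrA -mulrDl -!rmorphM -!rmorphD.
  rewrite e3 e2 e1 e0 /v !oE //= addr0 addrA !lin2 a0 b0.
  by rewrite !raddf0 !mul0r addr0.
pose p := (d * k).-1; pose q := d.-1.
(* A monomial sent to a multiple of s^p t^q has level at most floor(p/d) + floor(q/d) = k - 1. *)
have hI g : in_pow d k g -> (mmap f h g)`_p`_q = 0.
  move=> Ig; rewrite [g]mpolyE raddf_sum /= !coef_sum big_seq big1 // => m m_g.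
  rewrite mmapZ hX /= !coefCM.
  suff -> : ('X^(wA m) * ('X^(wB m))%:P : {poly {poly K}})`_p`_q = 0.
    by rewrite !mulr0.
  rewrite coefMC coefXn; case: eqP => [def_p|]; last by rewrite mul0r coef0.
  rewrite mul1r coefXn; case: eqP => // def_q.
  have: (k <= level d m)%N.
    by rewrite leqNgt; apply/negP => /Ig /eqP; rewrite mcoeff_eq0 m_g.
  suff: (level d m <= p %/ d + q %/ d)%N.
    have -> : (p %/ d = k.-1)%N.
      by rewrite /p -(ltn_predK k_gt0) mulnS -subn1 -addnBAC //; nia.
    by rewrite /q [(d.-1 %/ d)%N]divn_small; lia.
  have leq_sum_div (P : pred 'I_n.+4) : (\sum_(j | P j) m j %/ d <= (\sum_(j | P j)
    m j) %/ d)%N.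
    elim/big_ind2: _ => // x1 x2 y1 y2 le1 le2.
    by apply: leq_trans (leq_add_divn _ _ _); apply: leq_add.
  rewrite /level (bigID (fun j : 'I_n.+4 => (j < 2)%N)) /= def_p def_q.
  by apply: leq_add; apply: leq_sum_div.
(* [b1] and [b2] select nonzero coordinates of the kernel vectors, so x^m goes to a nonzero multiple
   of s^p t^q. *)
pose i1 := o b1; pose i2 := o (2 + b2).
pose m := (U_(i1) *+ p + U_(i2) *+ q)%MM.
have [|g _ Ig] := surj 'X_[m].
  by rewrite dhomogX /= /m mdegD !mdegMn !mdeg1 !mul1n def_i.
have /eqP := hI _ Ig; rewrite raddfB /= (rmorphM (mmap f h)) /= hlin mul0r subr0 hX.
have i1E : i1 = b1 :> nat by rewrite oE //; case: (b1).
have i2E : i2 = (2 + b2)%N :> nat by rewrite oE //; case: (b2).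
have ni12 : i1 != i2 by rewrite -val_eqE /= i1E i2E; case: (b1); case: (b2).
have wAm : wA m = p.
  rewrite /wA (bigD1 i1) ?i1E /=; last by case: (b1).
  rewrite big1 => [|j /andP[lt_j2 /negPf nji]].
    by rewrite /m mnmDE !mulmnE !mnm1E eqxx eq_sym (negPf ni12); lia.
  rewrite /m mnmDE !mulmnE !mnm1E eq_sym nji mul0n add0n.
  by case: eqP lt_j2 => // <-; rewrite i2E.
have wBm : wB m = q.
  rewrite /wB (bigD1 i2) ?i2E //= big1 => [|j /andP[ge_j2 /negPf nji]].
    by rewrite /m mnmDE !mulmnE !mnm1E eqxx (negPf ni12); lia.
  rewrite /m mnmDE !mulmnE !mnm1E [i2 == j]eq_sym nji mul0n addn0.
  by case: eqP ge_j2 => // <-; rewrite i1E; case: (b1).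
rewrite wAm wBm !(coefCM, coefMC, coefXn, eqxx, mul1r, mulr1).
rewrite prodf_seq_eq0 => /hasP[j _]; rewrite /= expf_eq0 => /andP[mj_gt0 vj0].
move: mj_gt0; rewrite /m mnmDE !mulmnE !mnm1E.
case: (i1 =P j) vj0 => [<-|_]; first by rewrite /v i1E;
  case: (b1) nz_a => /= /negPf ->.
case: (i2 =P j) => [<-|_ _]; first by rewrite /v i2E; case: (b2) nz_b => /= /negPf ->.
by rewrite !mul0n.
Qed.

End SurjectivityFailure.

(** * Relations among powers of linear forms *)

Section Relations.
Variable A : comNzRingType.
Implicit Types x y z w v a b c e : A.

(* The product of the eight forms x +- y +- z +- w, in terms of squares. *)
Definition norm4 a b c e : A :=
  ((a + b + c + e) ^+ 2
     - (a * b + a * c + a * e + b * c + b * e + c * e) *+ 4) ^+ 2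
  - (a * b * c * e) *+ 64.

(** One of the eight factors is x + y + z + w, with w = -(x + y + z). *)
Lemma norm4_eq0 x y z :
  norm4 (x ^+ 2) (y ^+ 2) (z ^+ 2) ((- (x + y + z)) ^+ 2) = 0.
Proof. by rewrite /norm4; ring. Qed.

(* norm4 a b c (sqrt e + sqrt v)^2 = norm5re + norm5im * 2 sqrt (e v) *)
Definition norm5re a b c e v : A :=
  let u1 := (e + v) ^+ 2 + (e * v) *+ 4 - (a + b + c) * (e + v) *+ 2
            + (a + b + c) ^+ 2 - (a * b + a * c + b * c) *+ 4 in
  let u2 := e + v - (a + b + c) in
  u1 ^+ 2 + (e * v * u2 ^+ 2) *+ 16 - (a * b * c * (e + v)) *+ 64.

Definition norm5im a b c e v : A :=
  let u1 := (e + v) ^+ 2 + (e * v) *+ 4 - (a + b + c) * (e + v) *+ 2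
            + (a + b + c) ^+ 2 - (a * b + a * c + b * c) *+ 4 in
  let u2 := e + v - (a + b + c) in
  (u1 * u2) *+ 4 - (a * b * c) *+ 64.

(* The product of the sixteen forms x +- y +- z +- w +- v. *)
Definition norm5 a b c e v : A :=
  norm5re a b c e v ^+ 2 - (e * v * norm5im a b c e v ^+ 2) *+ 4.

Lemma norm5_eq0 x y z w : let v := - (x + y + z + w) in
  norm5 (x ^+ 2) (y ^+ 2) (z ^+ 2) (w ^+ 2) (v ^+ 2) = 0.
Proof.
move=> v; rewrite /norm5.
set p := norm5re _ _ _ _ _; set q := norm5im _ _ _ _ _.
(* This factor is [norm4] at x^2, y^2, z^2, (w + v)^2, and x + y + z + (w + v) = 0. *)
have pq : p + (w * v * q) *+ 2 = 0.
  by rewrite /p /q /norm5re /norm5im /v; ring.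
have -> : p ^+ 2 - (w ^+ 2 * v ^+ 2 * q ^+ 2) *+ 4 =
    (p + (w * v * q) *+ 2) * (p - (w * v * q) *+ 2) by ring.
by rewrite pq mul0r.
Qed.

(* The next two relations were found by linear algebra: with s = x + y, the
   cubes (fourth powers) of x, y, z, w restricted to x + y + z + w = 0 are
   polynomials in s, xy and zw up to the factors x - y and z - w. *)
Definition rel3 x y z w : A :=
  let s := x + y in
  let p := x ^+ 3 + y ^+ 3 in let q := z ^+ 3 + w ^+ 3 in
  s * ((p + q) ^+ 3 *+ 14
       - ((p - q) * (x ^+ 3 * y ^+ 3 - z ^+ 3 * w ^+ 3)) *+ 54)
  + (x * x ^+ 3 + y * y ^+ 3) * ((p * q) *+ 9 - p ^+ 2 *+ 9 - q ^+ 2 *+ 63)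
  + (z * z ^+ 3 + w * w ^+ 3) * (p ^+ 2 *+ 63 - (p * q) *+ 9 + q ^+ 2 *+ 9).

Lemma rel3_eq0 x y z : rel3 x y z (- (x + y + z)) = 0.
Proof. by rewrite /rel3; ring. Qed.

Definition rel4 x y z w : A :=
  let s := x + y in
  let p := x ^+ 4 + y ^+ 4 in let q := z ^+ 4 + w ^+ 4 in
  let r := x ^+ 4 * y ^+ 4 in let t := z ^+ 4 * w ^+ 4 in
  let dx := x ^+ 4 - y ^+ 4 in let dz := z ^+ 4 - w ^+ 4 in
  (x - y) * (z - w) * (q ^+ 3 *+ 4 - p ^+ 3 *+ 4 + (p * q * (p - q)) *+ 24
     + (p * t - q * r) *+ 96 + (p * r - q * t) *+ 16)
  + s ^+ 2 * (dx * dz * (p - q)) *+ 16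
  + x * y * (dx * dz * (q *+ 84 - p *+ 4))
  + z * w * (dx * dz * (q *+ 4 - p *+ 84))
  + s * (x - y) * (dz * (t *+ 20 - r *+ 116
       + q ^+ 2 *+ 11 - (p * q) *+ 12 + p ^+ 2 *+ 25))
  + s * (z - w) * (dx * (r *+ 20 - t *+ 116
       + q ^+ 2 *+ 25 - (p * q) *+ 12 + p ^+ 2 *+ 11)).

Lemma rel4_eq0 x y z : rel4 x y z (- (x + y + z)) = 0.
Proof. by rewrite /rel4; ring. Qed.

End Relations.

(** * Behaviour of the relations under ring morphisms *)

Section RelationsMorphism.
Variables (A B : comNzRingType) (f : {rmorphism A -> B}).

Let fE := (rmorphMn f, rmorphXn f, rmorphN f, rmorphD f, rmorphM f).

Lemma rmorph_norm4 a b c e :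
  f (norm4 a b c e) = norm4 (f a) (f b) (f c) (f e).
Proof. by rewrite /norm4 !fE. Qed.

Lemma rmorph_norm5 a b c e v :
  f (norm5 a b c e v) = norm5 (f a) (f b) (f c) (f e) (f v).
Proof. by rewrite /norm5 /norm5re /norm5im; cbv zeta; rewrite !fE. Qed.

Lemma rmorph_rel3 x y z w : f (rel3 x y z w) = rel3 (f x) (f y) (f z) (f w).
Proof. by rewrite /rel3; cbv zeta; rewrite !fE. Qed.

Lemma rmorph_rel4 x y z w : f (rel4 x y z w) = rel4 (f x) (f y) (f z) (f w).
Proof. by rewrite /rel4; cbv zeta; rewrite !fE. Qed.

End RelationsMorphism.

(** * Failure of injectivity *)

Section InjectivityFailure.
Variable K : numFieldType.
Local Notation ones := ((fun=> 1) : _ -> K).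

Lemma mcoeff_restrict n (P : pred 'X_{1..n}) (f : {mpoly K[n]}) m :
  (\sum_(m' <- msupp f | P m') f@_m' *: 'X_[m'])@_m = if P m then f@_m else 0.
Proof.
rewrite raddf_sum /=; under eq_bigr do rewrite mcoeffZ mcoeffX.
rewrite -big_filter; have [m_in | m_notin] := boolP (m \in filter P (msupp f)).
  rewrite (bigD1_seq m) ?filter_uniq ?msupp_uniq //= eqxx mulr1 big1 =>
    [|m' /negPf->].
    by move: m_in; rewrite mem_filter addr0 => /andP[-> _].
  by rewrite mulr0.
rewrite big1_seq => [|m' /andP[_ m'_in]]; last first.
  by case: eqP m'_in m_notin => [-> ->|]; rewrite ?mulr0.
move: m_notin; rewrite mem_filter negb_and mcoeff_msupp negbK.
by case: (P m) => //= /eqP ->.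
Qed.

(** The factor theorem gives a cofactor H of no known degree; its component of degree i is a
    cofactor too, and injectivity would put it in the ideal power. *)
Lemma not_inj_at n d k i (F H : {mpoly K[n]}) :
  F \is i.+1.-homog -> in_pow d k F -> F = lin ones * H ->
  (forall G, in_pow d k G -> G \is i.-homog -> F <> lin ones * G) ->
  ~ inj_at d k (ones : 'I_n -> K) i.
Proof.
move=> FH IF def_F nF inj.
pose G := \sum_(m <- msupp H | mdeg m == i) H@_m *: 'X_[m].
have GH : G \is i.-homog.
  by apply: rpred_sum => m m_i; apply: dhomogZ; rewrite dhomogX.
have def_F' : F = lin ones * G.
  apply/mpolyP => m; have [deg_m | deg_m] := eqVneq (mdeg m) i.+1.
    rewrite def_F !mcoeff_lin; apply: eq_bigr => j _; case: eqP => // /eqP nz_mj.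
    have def_m : (m - U_(j) + U_(j))%MM = m by apply: submK; rewrite lep1mP.
    rewrite mcoeff_restrict (_ : mdeg _ == i) //.
    by have := congr1 mdeg def_m; rewrite mdegD mdeg1 deg_m addn1 => -[->].
  rewrite !(dhomog_nemf_coeff _ deg_m) //.
  by rewrite -add1n; apply: dhomogM => //; apply: lin_homog.
apply: (nF G) => //; apply: inj => //.
by rewrite -def_F'.
Qed.

(** Turns the vanishing of a relation at w = -s into divisibility by the linear form s + w. *)
Lemma horner_root_factor (A : comNzRingType) (p : {poly A}) s :
  p.[- s] = 0 -> exists q, forall w, p.[w] = (s + w) * q.[w].
Proof.
move=> /eqP; rewrite -[_ == 0]/(root p (- s)) => /factor_theorem[q ->].
by exists q => w; rewrite hornerM hornerXsubC opprK mulrC addrC.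
Qed.

(** A monomial of level at least k has degree at least dk. *)
Lemma homog_below n d k i (G : {mpoly K[n]}) : (0 < d)%N ->
  (i < d * k)%N -> G \is i.-homog -> in_pow d k G -> G = 0.
Proof.
move=> d_gt0 lt_i GH IG; apply/mpolyP => m; rewrite mcoeff0.
have [deg_m | deg_m] := eqVneq (mdeg m) i; last exact: dhomog_nemf_coeff deg_m.
apply: IG; rewrite -(ltn_pmul2l d_gt0) (leq_ltn_trans _ lt_i) //.
rewrite -deg_m mdegE /level big_distrr /=; apply: leq_sum => j _.
by rewrite mulnC leq_divM.
Qed.

Let var n (j : nat) : {mpoly K[n.+1]} := 'X_(inord j).

Lemma lin_ones4 : lin (ones : 'I_4 -> K) = var 3 0 + var 3 1 + var 3 2 + var 3 3.
Proof.
rewrite /lin !big_ord_recl big_ord0 addr0 !scale1r !addrA /var.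
do !congr (_ + _); congr ('X_ _); apply: val_inj; by rewrite /= inordK.
Qed.

Lemma lin_ones5 : lin (ones : 'I_5 -> K) =
  var 4 0 + var 4 1 + var 4 2 + var 4 3 + var 4 4.
Proof.
rewrite /lin !big_ord_recl big_ord0 addr0 !scale1r !addrA /var.
do !congr (_ + _); congr ('X_ _); apply: val_inj; by rewrite /= inordK.
Qed.

(** * Homogeneous elements of the powers of the ideal *)

Section HomogeneousPowers.
Variables (n d : nat).
Implicit Types f g : {mpoly K[n]}.

(** Level and degree are tracked together: a term that follows the shape of an explicit relation
    yields both. *)
Definition hpow k i f := in_pow d k f /\ f \is i.-homog.

Lemma hpowD k i f g : hpow k i f -> hpow k i g -> hpow k i (f + g).
Proof. by case=> If fH [Ig gH]; split; [apply: in_powD | apply: dhomogD]. Qed.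

Lemma hpowMn e k i f : hpow k i f -> hpow k i (f *+ e).
Proof.
by case=> If fH; rewrite -scaler_nat; split; [apply: in_powZ | apply: dhomogZ].
Qed.

Lemma hpowB k i f g : hpow k i f -> hpow k i g -> hpow k i (f - g).
Proof. by case=> If fH [Ig gH]; split; [apply: in_powB | apply: rpredB]. Qed.

Lemma hpowM k1 i1 k2 i2 f g :
  hpow k1 i1 f -> hpow k2 i2 g -> hpow (k1 + k2) (i1 + i2) (f * g).
Proof. by case=> If fH [Ig gH]; split; [apply: in_powM | apply: dhomogM]. Qed.

Lemma hpowX e k i f : hpow k i f -> hpow (k * e) (i * e) (f ^+ e).
Proof.
move=> hf; elim: e => [|e IH].
  by rewrite !muln0; split; [exact: in_pow0 | exact: dhomog1].
by rewrite !mulnS exprS; apply: hpowM.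
Qed.

Lemma hpow_var j : hpow 0 1 'X_j.
Proof. by split; [exact: in_pow0 | rewrite dhomogX /= mdeg1]. Qed.

Lemma hpow_varX j : (0 < d)%N -> hpow 1 d ('X_j ^+ d).
Proof.
move=> d_gt0; split; first exact: in_pow_var.
by have [_] := hpowX d (hpow_var j); rewrite mul1n.
Qed.

End HomogeneousPowers.

(** The cofactor of [norm4] has degree 7, below 2 * 4, so it would be 0 if it lay in the ideal
    power; but [norm4] is 1 at (1, 0, 0, 0). *)
Lemma not_inj_4_2 : ~ inj_at 2 4 (ones : 'I_4 -> K) 7.
Proof.
pose x j : {mpoly K[4]} := var 3 j.
pose N w := norm4 (x 0 ^+ 2) (x 1 ^+ 2) (x 2 ^+ 2) (w ^+ 2).
have [|q def_q] := @horner_root_factor _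
    (norm4 (x 0 ^+ 2)%:P (x 1 ^+ 2)%:P (x 2 ^+ 2)%:P ('X ^+ 2)) (x 0 + x 1 + x 2).
  rewrite -/(horner_eval _ _) rmorph_norm4 /= /horner_eval !hornerE.
  exact: norm4_eq0.
have def_N : N (x 3) = lin ones * q.[x 3].
  rewrite lin_ones4 -def_q -/(horner_eval _ _) rmorph_norm4 /=.
  by rewrite /horner_eval !hornerE.
have X j : hpow 2 1 2 (x j ^+ 2) by apply: hpow_varX.
have [IN NH] : hpow 2 4 8 (N (x 3)).
  rewrite /N /norm4.
  refine (hpowB (hpowX 2 (hpowB (hpowX 2 (hpowD (hpowD (hpowD (X 0) (X 1)) (X 2))
    (X 3)))
    (hpowMn 4 (hpowD (hpowD (hpowD (hpowD (hpowD (hpowM (X 0) (X 1)) (hpowM (X 0)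
      (X 2)))
     (hpowM (X 0) (X 3))) (hpowM (X 1) (X 2))) (hpowM (X 1) (X 3))) (hpowM (X 2) (X
       3))))))
    (hpowMn 64 (hpowM (hpowM (hpowM (X 0) (X 1)) (X 2)) (X 3)))).
apply: (not_inj_at NH IN def_N) => G IG GH.
rewrite (homog_below _ _ GH IG) // mulr0 => /(congr1 (meval (fun j : 'I_4 =>
  (j == 0%N :> nat)%:R))).
rewrite /N raddf0 rmorph_norm4 !rmorphXn /= !mevalXU !inordK //= /norm4.
by rewrite !expr0n !(mul0r, mulr0, mul0rn, addr0, subr0) !expr1n; apply/eqP/oner_neq0.
Qed.

(** As before with [norm5], of degree 8 in the squares: the cofactor has degree 15 < 16, and the
    value at (1, 0, 0, 0, 0) is 1. *)
Lemma not_inj_5_2 : ~ inj_at 2 8 (ones : 'I_5 -> K) 15.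
Proof.
pose x j : {mpoly K[5]} := var 4 j.
pose N w := norm5 (x 0 ^+ 2) (x 1 ^+ 2) (x 2 ^+ 2) (x 3 ^+ 2) (w ^+ 2).
have [|q def_q] := @horner_root_factor _
    (norm5 (x 0 ^+ 2)%:P (x 1 ^+ 2)%:P (x 2 ^+ 2)%:P (x 3 ^+ 2)%:P ('X ^+ 2))
    (x 0 + x 1 + x 2 + x 3).
  rewrite -/(horner_eval _ _) rmorph_norm5 /= /horner_eval !hornerE.
  exact: norm5_eq0.
have def_N : N (x 4) = lin ones * q.[x 4].
  rewrite lin_ones5 -def_q -/(horner_eval _ _) rmorph_norm5 /=.
  by rewrite /horner_eval !hornerE.
have X j : hpow 2 1 2 (x j ^+ 2) by apply: hpow_varX.
have [IN NH] : hpow 2 8 16 (N (x 4)).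
  have S3 := hpowD (hpowD (X 0) (X 1)) (X 2).
  have S2 := hpowD (X 3) (X 4).
  have P2 := hpowM (X 3) (X 4).
  have P3 := hpowM (hpowM (X 0) (X 1)) (X 2).
  have E2 := hpowD (hpowD (hpowM (X 0) (X 1)) (hpowM (X 0) (X 2))) (hpowM (X 1) (X
    2)).
  have U1 : hpow 2 2 4 _ := hpowB (hpowD (hpowB (hpowD (hpowX 2 S2) (hpowMn 4 P2))
    (hpowMn 2 (hpowM S3 S2))) (hpowX 2 S3)) (hpowMn 4 E2).
  have U2 : hpow 2 1 2 _ := hpowB S2 S3.
  have R : hpow 2 4 8 _ :=
    hpowB (hpowD (hpowX 2 U1) (hpowMn 16 (hpowM P2 (hpowX 2 U2))))
    (hpowMn 64 (hpowM P3 S2)).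
  have J : hpow 2 3 6 _ := hpowB (hpowMn 4 (hpowM U1 U2)) (hpowMn 64 P3).
  rewrite /N /norm5 /norm5re /norm5im.
  refine (hpowB (hpowX 2 R) (hpowMn 4 (hpowM P2 (hpowX 2 J)))).
apply: (not_inj_at NH IN def_N) => G IG GH.
rewrite (homog_below _ _ GH IG) // mulr0.
move=> /(congr1 (meval (fun j : 'I_5 => (j == 0%N :> nat)%:R))).
rewrite /N raddf0 rmorph_norm5 !rmorphXn /= !mevalXU !inordK //=.
rewrite /norm5 /norm5re /norm5im /= !expr0n /= !expr1n.
rewrite !(mul0r, mulr0, mul0rn, addr0, add0r, subr0) !expr1n !expr0n /=.
by rewrite !(mul0r, mul0rn, addr0, add0r, subr0, expr1n); apply/eqP/oner_neq0.
Qed.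

(* Restriction to the coordinates a and b, dehomogenized by x_a = 1. *)
Let plane n (a b : nat) : {mpoly K[n.+1]} -> {poly K} :=
  mmap (@polyC K) (fun j : 'I_n.+1 => if j == a :> nat then 1
                     else if j == b :> nat then 'X else 0).

(** The only monomial of degree i restricting to X^e is x_a^(i-e) x_b^e, of level floor((i-e)/d) +
    floor(e/d). *)
Lemma coef_plane n d k i a b e (G : {mpoly K[n.+1]}) :
  (a <= n)%N -> (b <= n)%N -> a != b ->
  in_pow d k G -> G \is i.-homog -> (e <= i)%N ->
  ((i - e) %/ d + e %/ d < k)%N -> (plane a b G)`_e = 0.
Proof.
move=> le_a le_b nab IG GH le_e lt_k;
  rewrite /plane [G]mpolyE raddf_sum /= coef_sum big_seq.
rewrite big1 // => m m_G; rewrite mmapZ mmapX coefCM.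
have [j /andP[/andP[nja njb] nz_mj] | only_ab] := pickP (fun j : 'I_n.+1 =>
    (j != a :> nat) && (j != b :> nat) && (m j != 0%N)).
  by rewrite /mmap1 (bigD1 j) //= (negPf nja) (negPf njb) expr0n (negPf nz_mj)
    mul0r coef0 mulr0.
pose ja : 'I_n.+1 := inord a; pose jb : 'I_n.+1 := inord b.
have jaE : ja = a :> nat by rewrite inordK.
have jbE : jb = b :> nat by rewrite inordK.
have njab : jb != ja by rewrite -val_eqE /= jaE jbE eq_sym.
have m0 j : j != ja -> j != jb -> m j = 0%N.
  rewrite -!val_eqE /= jaE jbE => nja njb; apply/eqP.
  by have := only_ab j; rewrite nja njb /= => /negbFE.
have split_m (F : nat -> nat) : F 0%N = 0%N ->
  (\sum_j F (m j) = F (m ja) + F (m jb))%N.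
  move=> F0; rewrite (bigD1 ja) //= (bigD1 jb) ?njab //= big1 ?addn0 // =>
    j /andP[nja njb].
  by rewrite m0.
have -> : mmap1 (fun j : 'I_n.+1 => if j == a :> nat then 1
    else if j == b :> nat then 'X else 0) m = 'X^(m jb) :> {poly K}.
  rewrite /mmap1 (bigD1 ja) //= (bigD1 jb) ?njab //= jaE eqxx expr1n mul1r.
  rewrite jbE [b == a]eq_sym (negPf nab) eqxx big1 ?mulr1 // => j /andP[nja njb].
  by rewrite m0 // expr0.
rewrite coefXn; case: eqP => [def_e | _]; last by rewrite mulr0.
rewrite IG ?mul0r //; apply: leq_ltn_trans lt_k.
rewrite /level (split_m (fun x => (x %/ d)%N)) ?div0n // def_e.
have := dhomog_mf GH m_G; rewrite /= mdegE (split_m id) // => <-.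
by rewrite addnK.
Qed.

(** The cofactor has degree 9 = 3 * 3, so degree alone does not keep it out of the ideal power; its
    restriction to two coordinates does. *)
Lemma not_inj_4_3 : ~ inj_at 3 3 (ones : 'I_4 -> K) 9.
Proof.
pose x j : {mpoly K[4]} := var 3 j.
pose F w := rel3 (x 0) (x 1) (x 2) w.
have [|q def_q] := @horner_root_factor _
    (rel3 (x 0)%:P (x 1)%:P (x 2)%:P 'X) (x 0 + x 1 + x 2).
  by rewrite -/(horner_eval _ _) rmorph_rel3 /= /horner_eval !hornerE rel3_eq0.
have def_F : F (x 3) = lin ones * q.[x 3].
  rewrite lin_ones4 -def_q -/(horner_eval _ _) rmorph_rel3 /=.
  by rewrite /horner_eval !hornerE.
have x1 j : hpow 3 0 1 (x j) by apply: hpow_var.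
have X j : hpow 3 1 3 (x j ^+ 3) by apply: hpow_varX.
have [IF FH] : hpow 3 3 10 (F (x 3)).
  have P := hpowD (X 0) (X 1); have Q := hpowD (X 2) (X 3).
  have U := hpowD (hpowM (x1 0) (X 0)) (hpowM (x1 1) (X 1)).
  have V := hpowD (hpowM (x1 2) (X 2)) (hpowM (x1 3) (X 3)).
  rewrite /F /rel3.
  refine (hpowD (hpowD
    (hpowM (hpowD (x1 0) (x1 1)) (hpowB (hpowMn 14 (hpowX 3 (hpowD P Q)))
      (hpowMn 54 (hpowM (hpowB P Q) (hpowB (hpowM (X 0) (X 1)) (hpowM (X 2) (X
        3)))))))
    (hpowM U (hpowB (hpowB (hpowMn 9 (hpowM P Q)) (hpowMn 9 (hpowX 2 P))) (hpowMn
      63 (hpowX 2 Q)))))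
    (hpowM V (hpowD (hpowB (hpowMn 63 (hpowX 2 P)) (hpowMn 9 (hpowM P Q))) (hpowMn
      9 (hpowX 2 Q))))).
apply: (not_inj_at FH IF def_F) => G IG GH /(congr1 (@plane 3 0 3)).
(* Since floor(8/3) + floor(1/3) < 3. Hence the coefficients 0 and 1 of (1 + X) g agree, whereas
   those of the relation are 5 and 0. *)
have g1 : (plane 0 3 G)`_1 = 0 by apply: (coef_plane _ _ _ IG GH).
rewrite /F /plane rmorph_rel3 rmorphM lin_ones4 !rmorphD /=. rewrite !mmapX !mmap1U
  !inordK //=.
rewrite -/(plane 0 3 G) !addr0 => def_g.
have relE : rel3 1 0 0 'X = 1 *+ 5 + 'X^2 * ('X *+ 51 + 'X^2 *+ 63 - 'X^4 *+ 21
    - 'X^5 *+ 9 + 'X^7 *+ 14 + 'X^8 *+ 9) :> {poly K} by rewrite /rel3; ring.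
have := congr1 (fun p : {poly K} => p`_0 - p`_1) def_g.
rewrite /= relE mulrDl mul1r !(coefMn, coefXnM, coefXM, coefD, coef1) /= g1.
rewrite !(addr0, mul0rn, add0r, subr0) subrr => /eqP.
by rewrite pnatr_eq0.
Qed.

Lemma not_inj_4_4 : ~ inj_at 4 3 (ones : 'I_4 -> K) 13.
Proof.
pose x j : {mpoly K[4]} := var 3 j.
pose F w := rel4 (x 0) (x 1) (x 2) w.
have [|f def_f] := @horner_root_factor _
    (rel4 (x 0)%:P (x 1)%:P (x 2)%:P 'X) (x 0 + x 1 + x 2).
  by rewrite -/(horner_eval _ _) rmorph_rel4 /= /horner_eval !hornerE rel4_eq0.
have def_F : F (x 3) = lin ones * f.[x 3].
  rewrite lin_ones4 -def_f -/(horner_eval _ _) rmorph_rel4 /=.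
  by rewrite /horner_eval !hornerE.
have x1 j : hpow 4 0 1 (x j) by apply: hpow_var.
have X j : hpow 4 1 4 (x j ^+ 4) by apply: hpow_varX.
have [IF FH] : hpow 4 3 14 (F (x 3)).
  have p := hpowD (X 0) (X 1); have q := hpowD (X 2) (X 3).
  have r := hpowM (X 0) (X 1); have t := hpowM (X 2) (X 3).
  have dx := hpowB (X 0) (X 1); have dz := hpowB (X 2) (X 3).
  have s := hpowD (x1 0) (x1 1).
  have a := hpowB (x1 0) (x1 1); have b := hpowB (x1 2) (x1 3).
  rewrite /F /rel4.
  refine (hpowD (hpowD (hpowD (hpowD (hpowD
   (hpowM (hpowM a b) (hpowD (hpowD (hpowD (hpowB (hpowMn 4 (hpowX 3 q)) (hpowMn 4
     (hpowX 3 p)))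
      (hpowMn 24 (hpowM (hpowM p q) (hpowB p q))))
      (hpowMn 96 (hpowB (hpowM p t) (hpowM q r))))
      (hpowMn 16 (hpowB (hpowM p r) (hpowM q t)))))
   (hpowMn 16 (hpowM (hpowX 2 s) (hpowM (hpowM dx dz) (hpowB p q)))))
   (hpowM (hpowM (x1 0) (x1 1)) (hpowM (hpowM dx dz) (hpowB (hpowMn 84 q) (hpowMn 4
     p)))))
   (hpowM (hpowM (x1 2) (x1 3)) (hpowM (hpowM dx dz) (hpowB (hpowMn 4 q) (hpowMn 84
     p)))))
   (hpowM (hpowM s a) (hpowM dz (hpowD (hpowB (hpowD (hpowB (hpowMn 20 t) (hpowMn
     116 r))
      (hpowMn 11 (hpowX 2 q))) (hpowMn 12 (hpowM p q))) (hpowMn 25 (hpowX 2 p))))))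
   (hpowM (hpowM s b) (hpowM dx (hpowD (hpowB (hpowD (hpowB (hpowMn 20 r) (hpowMn
     116 t))
      (hpowMn 25 (hpowX 2 q))) (hpowMn 12 (hpowM p q))) (hpowMn 11 (hpowX 2 p)))))).
apply: (not_inj_at FH IF def_F) => G IG GH /(congr1 (@plane 3 0 2)).
(* Since floor(11/4) + floor(2/4) < 3. This coefficient is the alternating sum of the first three
   coefficients of (1 + X) g, which for the relation is -7. *)
have g2 : (plane 0 2 G)`_2 = 0 by apply: (coef_plane _ _ _ IG GH).
rewrite /F /plane rmorph_rel4 rmorphM lin_ones4 !rmorphD /= !mmapX !mmap1U !inordK
  //=.
rewrite -/(plane 0 2 G) !addr0 => def_g.
have relE : rel4 1 0 'X 0 = 'X *+ 7 + 'X^3 * ('X *+ 41 + 'X^2 *+ 12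
    - 'X^5 *+ 28 + 'X^6 + 'X^9 *+ 11 + 'X^10 *+ 4) :> {poly K} by rewrite /rel4; ring.
have := congr1 (fun p : {poly K} => p`_0 - p`_1 + p`_2) def_g.
rewrite /= relE mulrDl mul1r !(coefMn, coefXnM, coefXM, coefD, coefX) /= g2.
set u := (plane 0 2 G)`_0; set v := (plane 0 2 G)`_1 => uv.
have : (7%:R : K) = 0.
  rewrite [LHS](_ : _ = - (0 *+ 7 + 0 - (1 *+ 7 + 0) + (0 *+ 7 + 0))); last by ring.
  by rewrite uv; ring.
by move/eqP; rewrite pnatr_eq0.
Qed.

Lemma not_inj_at_le n d k k' i (c : 'I_n.+1 -> K) : (0 < d)%N -> (k <= k')%N ->
  ~ inj_at d k c i -> ~ inj_at d k' c (d * (k' - k) + i).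
Proof.
move=> d_gt0 /subnK => def_k'; rewrite -[in inj_at _ k']def_k'.
elim: (k' - k)%N => [|e IH] ninj; first by rewrite muln0.
by rewrite mulnS -addnA => /inj_at_shift inj; apply: (IH ninj); apply: inj.
Qed.

End InjectivityFailure.

(** * Surjectivity *)

Section Surjectivity.
Variables (K : numFieldType).
Local Notation ones := ((fun=> 1) : _ -> K).

Lemma sub_multinom n e (m : 'X_{1..n}) : (e <= mdeg m)%N ->
  exists2 m1, mdeg m1 = e & (m1 <= m)%MM.
Proof.
elim: e => [|e IH] lt_e.
  by exists 0%MM; [exact: mdeg0 | apply/mnm_lepP => i; rewrite mnm0E].
have [m1 deg_m1 le_m] := IH (ltnW lt_e).
have [j nz_j] : exists j, (m - m1)%MM j != 0%N.
  apply/existsP; apply: contraLR lt_e; rewrite negb_exists => /forallP m0.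
  rewrite -leqNgt -deg_m1 -(submK le_m) mdegD mdegE big1 // => j _.
  by apply/eqP; rewrite -[_ == _]negbK m0.
exists (m1 + U_(j))%MM; first by rewrite mdegD mdeg1 deg_m1 addn1.
apply/mnm_lepP => l; rewrite mnmDE mnm1E; move/mnm_lepP/(_ l): le_m nz_j.
by rewrite mnmBE; case: (j =P l) => [<-|_]; lia.
Qed.

(** Induction on k: a factor x^m1 of degree 2d - 1 is, by the case k = 1, a multiple of the form
    plus some g in the ideal. Each monomial of g contains some x_j^d; without it, the induction
    hypothesis applies. *)
Lemma surj_at_pow n d k (c : 'I_n -> K) : (1 < d)%N ->
  surj_at d 1 c (d + d.-2) -> surj_at d k.+1 c (d * k + (d + d.-2)).
Proof.
move=> d_gt1 surj; elim: k => [|k IH]; first by rewrite muln0.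
apply: surj_at_monomials => m deg_m.
have [|m1 deg_m1 le_m] := @sub_multinom n (d + d.-2).+1 m; first by rewrite deg_m;
  lia.
have [|f fH] := surj 'X_[m1]; first by rewrite dhomogX /= deg_m1.
set g := _ - _ => Ig; pose m2 := (m - m1)%MM.
have def_m : (m2 + m1)%MM = m by apply: submK.
have deg_m2 : mdeg m2 = (d * k.+1)%N.
  by have := congr1 mdeg def_m; rewrite mdegD deg_m1 deg_m; lia.
have gH : g \is (d + d.-2).+1.-homog.
  apply: rpredB; first by rewrite dhomogX /= deg_m1.
  by rewrite -add1n; apply: dhomogM => //; apply: lin_homog.
suff [f' f'H If'] : exists2 f', f' \is (d * k.+1 + (d + d.-2)).-homog &
    in_pow d k.+2 ('X_[m2] * g - lin c * f').
  exists ('X_[m2] * f + f'); first by apply: rpredD => //; apply: dhomogM;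
    rewrite // dhomogX /= deg_m2.
  rewrite -def_m mpolyXD; suff -> : 'X_[m2] * 'X_[m1] - lin c * ('X_[m2] * f + f') =
    'X_[m2] * g - lin c * f' by [].
  by rewrite /g; ring.
rewrite [g]mpolyE big_seq mulr_sumr.
elim/big_ind: _ => [|p q [f1 f1H I1] [f2 f2H I2]|m' m'_g].
- by exists 0; [exact: dhomog0 | rewrite mulr0 subr0; apply: in_pow_zero].
- exists (f1 + f2); first exact: dhomogD.
  by rewrite mulrDr opprD addrACA; apply: in_powD.
have [j le_dj] : exists j, (d <= m' j)%N.
  apply/existsP; apply: contraLR m'_g; rewrite negb_exists => /forallP lt_d.
  rewrite mcoeff_msupp negbK Ig // /level big1 // => j _.
  by rewrite divn_small // ltnNge.
have def_m' : (m' - U_(j) *+ d + U_(j) *+ d)%MM = m'.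
  by apply: submK; apply/mnm_lepP => l; rewrite mulmnE mnm1E; case: eqP => [<-|_];
    lia.
have [|f' f'H If'] := IH 'X_[m2 + (m' - U_(j) *+ d)].
  rewrite dhomogX /= mdegD deg_m2; have := dhomog_mf gH m'_g.
  by rewrite -{1}def_m' /= mdegD mdegMn mdeg1; lia.
exists (g@_m' *: ('X_j ^+ d * f')).
  apply: dhomogZ; rewrite mulnS -addnA; apply: dhomogM => //.
  by rewrite mpolyXn dhomogX /= mdegMn mdeg1 mul1n.
rewrite -!scalerAr -scalerBr -{2}def_m' !mpolyXD -mpolyXn; apply: in_powZ.
have -> : 'X_[m2] * ('X_[m' - U_(j) *+ d] * 'X_j ^+ d) - lin c * ('X_j ^+ d * f') =
   'X_j ^+ d * ('X_[m2 + (m' - U_(j) *+ d)] - lin c * f').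
  by rewrite mpolyXD; ring.
by apply/in_pow_mulXd => //; lia.
Qed.

(** * Computation modulo the linear form and the d-th powers *)

Section ModuloLinear.
Variables (n d : nat).
Implicit Types f g : {mpoly K[n]}.

(** For d > 0, the ideal generated by the x_i^d and x_1 + ... + x_n. The cofactor is arbitrary;
    [surj_at_in_ideal] extracts its component of the right degree. *)
Definition in_ideal f := exists g, in_pow d 1 (f - lin ones * g).

Lemma surj_at_in_ideal i :
  (forall m : 'X_{1..n}, mdeg m = i.+1 -> in_ideal 'X_[m]) ->
  surj_at d 1 (ones : 'I_n -> K) i.
Proof.
move=> Qm; apply: surj_at_monomials => m /[dup] deg_m /Qm[g Ig].
pose f := \sum_(m' <- msupp g | mdeg m' == i) g@_m' *: 'X_[m'].
exists f => [|m' lt_m'].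
  by apply: rpred_sum => m' m'_i; apply: dhomogZ; rewrite dhomogX.
have [deg_m' | deg_m'] := eqVneq (mdeg m') i.+1.
  rewrite -[RHS](Ig m' lt_m') !mcoeffB !mcoeff_lin; congr (_ - _).
  apply: eq_bigr => j _; case: eqP => // /eqP nz_j.
  have def_m' : (m' - U_(j) + U_(j))%MM = m' by apply: submK; rewrite lep1mP.
  rewrite mcoeff_restrict (_ : mdeg _ == i) //.
  by have := congr1 mdeg def_m'; rewrite mdegD mdeg1 deg_m' addn1 => -[->].
rewrite mcoeffB (dhomog_nemf_coeff (d := i.+1) _ deg_m') ?dhomogX /= ?deg_m //.
rewrite (dhomog_nemf_coeff (d := i.+1) _ deg_m') ?subr0 //.
rewrite -add1n; apply: dhomogM; first exact: lin_homog.
by apply: rpred_sum => m'' m_i; apply: dhomogZ; rewrite dhomogX.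
Qed.

Lemma in_idealD f g : in_ideal f -> in_ideal g -> in_ideal (f + g).
Proof.
move=> [f' If] [g' Ig]; exists (f' + g').
by rewrite mulrDr opprD addrACA; apply: in_powD.
Qed.

Lemma in_idealMl f g : in_ideal g -> in_ideal (f * g).
Proof.
move=> [g' Ig]; exists (f * g'); rewrite mulrCA -mulrBr; exact: in_powMl.
Qed.

Lemma in_idealMr f g : in_ideal f -> in_ideal (f * g).
Proof. by rewrite mulrC; exact: in_idealMl. Qed.

Lemma in_idealN f : in_ideal f -> in_ideal (- f).
Proof. by rewrite -mulN1r; exact: in_idealMl. Qed.

Lemma in_idealB f g : in_ideal f -> in_ideal g -> in_ideal (f - g).
Proof. by move=> Qf Qg; apply: in_idealD => //; apply: in_idealN. Qed.

Lemma in_ideal_lin : in_ideal (lin ones).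
Proof. by exists 1; rewrite mulr1 subrr; exact: in_pow_zero. Qed.

Lemma in_ideal_varX j : (0 < d)%N -> in_ideal ('X_j ^+ d).
Proof. by move=> d_gt0; exists 0; rewrite mulr0 subr0; exact: in_pow_var. Qed.

Lemma in_idealMn e f : in_ideal (f *+ e.+1) -> in_ideal f.
Proof.
move=> Qf; rewrite -[f](scalerK (a := e.+1%:R)) ?pnatr_eq0 //.
by rewrite scaler_nat -mul_mpolyC; apply: in_idealMl.
Qed.

(** Modulo the sum, x + y + z is -t: the variable t is traded for a d-th power of the sum of the
    others. *)
Lemma in_ideal_sum3 x y z t : (0 < d)%N -> in_ideal (x + y + z + t) ->
  in_ideal (t ^+ d) -> in_ideal ((x + y + z) ^+ d).
Proof.
move=> d_gt0 Ql Qt.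
have := subrXX (x + y + z) (- t) d; rewrite opprK => /eqP.
rewrite subr_eq => /eqP ->; apply: in_idealD; first exact: in_idealMr.
by rewrite exprNn; apply: in_idealMl.
Qed.

End ModuloLinear.

(** * Monomials of degree 2d - 1 in three variables *)

Section ThreeVariables.
Variables (n d : nat) (x y z : {mpoly K[n]}).
Hypotheses (Qx : in_ideal d (x ^+ d)) (Qy : in_ideal d (y ^+ d)).
Hypotheses (Qz : in_ideal d (z ^+ d)) (Qs : in_ideal d ((x + y + z) ^+ d)).

(** Format of the explicit certificates below; e + 1 is their common denominator, invertible in
    characteristic zero. *)
Lemma in_ideal_comb (u p q r t : {mpoly K[n]}) e :
  u *+ e.+1 = (x + y + z) ^+ d * t + x ^+ d * p + y ^+ d * q + z ^+ d * r ->
  in_ideal d u.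
Proof.
move=> def_u; apply: (@in_idealMn _ _ e); rewrite def_u.
by do 3!(apply: in_idealD; last exact: in_idealMr); exact: in_idealMr.
Qed.

Lemma in_ideal_111 : d = 2%N -> in_ideal d (x * y * z).
Proof.
move=> d2; apply: (@in_ideal_comb _ (- z) (- z)
  (- (x *+ 2) - y *+ 2 - z) z 1).
by rewrite d2; ring.
Qed.

Lemma in_ideal_221 : d = 3%N -> in_ideal d (x ^+ 2 * y ^+ 2 * z).
Proof.
move=> d3; apply: (@in_ideal_comb _
  (z ^+ 2 - x * y - y ^+ 2 *+ 3 - y * z *+ 3)
  (z ^+ 2 - x ^+ 2 *+ 3 - x * y - x * z *+ 3)
  (x ^+ 2 *+ 3 + x * y *+ 5 + x * z *+ 3 + y ^+ 2 *+ 3 + y * z *+ 3 + z ^+ 2)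
  (x * y - z ^+ 2) 5).
by rewrite d3; ring.
Qed.

Lemma in_ideal_322 : d = 4%N -> in_ideal d (x ^+ 3 * y ^+ 2 * z ^+ 2).
Proof.
move=> d4; apply: (@in_ideal_comb _
  (- (x ^+ 3 *+ 3 + x ^+ 2 * y *+ 12 + x ^+ 2 * z *+ 12 + x * y ^+ 2 *+ 15
    + x * y * z *+ 40 + x * z ^+ 2 *+ 15 + y ^+ 2 * z *+ 40 + y * z ^+ 2 *+ 40))
  (x ^+ 3 *+ 15 + x ^+ 2 * y *+ 12 + x ^+ 2 * z *+ 20 + x * y ^+ 2 *+ 3
    + x * y * z *+ 8 + x * z ^+ 2 *+ 5)
  (x ^+ 3 *+ 15 + x ^+ 2 * y *+ 20 + x ^+ 2 * z *+ 12 + x * y ^+ 2 *+ 5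
    + x * y * z *+ 8 + x * z ^+ 2 *+ 3)
  (x * (x ^+ 2 *+ 3 + y * z *+ 4 - y ^+ 2 *+ 3 - z ^+ 2 *+ 3)) 29).
by rewrite d4; ring.
Qed.

Lemma in_ideal_331 : d = 4%N -> in_ideal d (x ^+ 3 * y ^+ 3 * z).
Proof.
move=> d4; apply: (@in_ideal_comb _
  (x ^+ 3 + x ^+ 2 * y + x ^+ 2 * z *+ 4 - x * y ^+ 2 *+ 9 + x * y * z *+ 4
    + x * z ^+ 2 *+ 6 - y ^+ 3 *+ 25 - y ^+ 2 * z *+ 20 + y * z ^+ 2 *+ 10)
  (y ^+ 3 + x * y ^+ 2 + y ^+ 2 * z *+ 4 - x ^+ 2 * y *+ 9 + x * y * z *+ 4
    + y * z ^+ 2 *+ 6 - x ^+ 3 *+ 25 - x ^+ 2 * z *+ 20 + x * z ^+ 2 *+ 10)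
  (- (x ^+ 3 *+ 15 + x ^+ 2 * y *+ 35 + x ^+ 2 * z *+ 24 + x * y ^+ 2 *+ 35
    + x * y * z *+ 44 + x * z ^+ 2 *+ 16 + y ^+ 3 *+ 15 + y ^+ 2 * z *+ 24
    + y * z ^+ 2 *+ 16 + z ^+ 3 *+ 4))
  (z ^+ 3 *+ 4 - x * y * z *+ 4 + (x * y * (x + y)) *+ 3 - x ^+ 3 - y ^+ 3) 39).
by rewrite d4; ring.
Qed.

End ThreeVariables.

(** Up to order, the exponents below d with sum 2d - 1 are 111 for d = 2, 221 for d = 3, and 322 and
    331 for d = 4. *)
Lemma in_ideal_monomial3 n d (x y z : {mpoly K[n]}) a b c : (1 < d < 5)%N ->
  in_ideal d (x ^+ d) -> in_ideal d (y ^+ d) -> in_ideal d (z ^+ d) ->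
  in_ideal d ((x + y + z) ^+ d) -> (a + b + c = (d + d.-2).+1)%N ->
  in_ideal d (x ^+ a * y ^+ b * z ^+ c).
Proof.
move=> d_bounds Qx Qy Qz Qs deg.
have big_exp (u : {mpoly K[n]}) e : in_ideal d (u ^+ d) -> (d <= e)%N ->
  in_ideal d (u ^+ e).
  by move=> Qu /subnK <-; rewrite exprD; apply: in_idealMl.
case: (leqP d a) => [/big_exp Qa | lt_a]; first by do 2!apply: in_idealMr; apply: Qa.
case: (leqP d b) => [/big_exp Qb | lt_b].
  by apply: in_idealMr; apply: in_idealMl; apply: Qb.
case: (leqP d c) => [/big_exp Qc | lt_c]; first by apply: in_idealMl; apply: Qc.
have [d2|[d3|d4]] : (d = 2 \/ d = 3 \/ d = 4)%N by lia.
- rewrite d2 in lt_a lt_b lt_c deg.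
  move: a b c lt_a lt_b lt_c deg => [|[|a]] [|[|b]] [|[|c]] // _ _ _ _.
  by rewrite !expr1; apply: in_ideal_111.
- rewrite d3 in lt_a lt_b lt_c deg.
  move: a b c lt_a lt_b lt_c deg => [|[|[|a]]] [|[|[|b]]] [|[|[|c]]] // _ _ _ _;
    rewrite expr1.
  + rewrite -mulrA mulrC; apply: (in_ideal_221 Qy Qz Qx _ d3).
    by rewrite addrC addrA.
  + rewrite mulrAC; apply: (in_ideal_221 Qx Qz Qy _ d3).
    by rewrite addrAC.
  + exact: (in_ideal_221 Qx Qy Qz Qs d3).
rewrite d4 in lt_a lt_b lt_c deg.
move: a b c lt_a lt_b lt_c deg =>
  [|[|[|[|a]]]] [|[|[|[|b]]]] [|[|[|[|c]]]] // _ _ _ _.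
- rewrite -mulrA mulrC expr1; apply: (in_ideal_331 Qy Qz Qx _ d4).
  by rewrite addrC addrA.
- rewrite mulrC mulrA; apply: (in_ideal_322 Qz Qx Qy _ d4).
  by rewrite -addrA addrC.
- rewrite [x ^+ 2 * _]mulrC; apply: (in_ideal_322 Qy Qx Qz _ d4).
  by rewrite [y + x]addrC.
- rewrite mulrAC expr1; apply: (in_ideal_331 Qx Qz Qy _ d4).
  by rewrite addrAC.
- exact: (in_ideal_322 Qx Qy Qz Qs d4).
- by rewrite expr1; apply: (in_ideal_331 Qx Qy Qz Qs d4).
Qed.

(** Replacing one x_3 by -(x_0 + x_1 + x_2) keeps the degree; induction on its exponent leaves three
    variables. *)
Lemma in_ideal_monomial4 d m : (1 < d < 5)%N -> mdeg m = (d + d.-2).+1 ->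
  in_ideal d ('X_[m] : {mpoly K[4]}).
Proof.
move=> d_bounds deg_m; have d_gt0 : (0 < d)%N by lia.
pose x j : {mpoly K[4]} := 'X_(inord j); pose a j := m (inord j).
have Qx j : in_ideal d (x j ^+ d) by apply: in_ideal_varX.
have Ql := @in_ideal_lin 4 d.
rewrite lin_ones4 -/(x 0) -/(x 1) -/(x 2) -/(x 3) in Ql.
have -> : 'X_[m] = x 0 ^+ a 0 * x 1 ^+ a 1 * x 2 ^+ a 2 * x 3 ^+ a 3.
  rewrite mpolyXE_id !big_ord_recl big_ord0 mulr1 !mulrA /x /a.
  do !congr (_ * _); congr ('X_ _ ^+ m _); apply: val_inj; by rewrite /= inordK.
have: (a 0 + a 1 + a 2 + a 3 = (d + d.-2).+1)%N.
  rewrite -deg_m mdegE !big_ord_recl big_ord0 addn0 !addnA /a.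
  do !congr (_ + _)%N; congr (m _); apply: val_inj; by rewrite /= inordK.
elim: (a 3) (a 0) (a 1) (a 2) => [|e IH] a0 a1 a2 deg.
  rewrite expr0 mulr1; apply: in_ideal_monomial3; rewrite ?addn0 // in deg *.
  exact: in_ideal_sum3 (x 3) _ Ql _.
set u := x 0 ^+ a0 * x 1 ^+ a1 * x 2 ^+ a2 * x 3 ^+ e.
have -> : x 0 ^+ a0 * x 1 ^+ a1 * x 2 ^+ a2 * x 3 ^+ e.+1 =
    u * (x 0 + x 1 + x 2 + x 3)
    - (x 0 ^+ a0.+1 * x 1 ^+ a1 * x 2 ^+ a2 * x 3 ^+ e
       + x 0 ^+ a0 * x 1 ^+ a1.+1 * x 2 ^+ a2 * x 3 ^+ e
       + x 0 ^+ a0 * x 1 ^+ a1 * x 2 ^+ a2.+1 * x 3 ^+ e).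
  by rewrite /u !exprS; ring.
apply: in_idealB; first exact: in_idealMl.
by do 2!(apply: in_idealD; last by apply: IH; lia); apply: IH; lia.
Qed.

(** With P = p + q + r and S = s + t, P + S divides P^3 + S^3, and modulo the squares P^3 = 6pqr and
    S^3 = 0. *)
Lemma in_ideal_prod3 n (p q r s t : {mpoly K[n]}) :
  in_ideal 2 (p ^+ 2) -> in_ideal 2 (q ^+ 2) -> in_ideal 2 (r ^+ 2) ->
  in_ideal 2 (s ^+ 2) -> in_ideal 2 (t ^+ 2) -> in_ideal 2 (p + q + r + s + t) ->
  in_ideal 2 (p * q * r).
Proof.
move=> Qp Qq Qr Qs Qt Ql; apply: (@in_idealMn _ _ 5).
have -> : p * q * r *+ 6 =
    (p + q + r + s + t) * ((p + q + r) ^+ 2 - (p + q + r) * (s + t) + (s + t) ^+ 2)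
    + p ^+ 2 * - (p + q *+ 3 + r *+ 3) + q ^+ 2 * - (q + p *+ 3 + r *+ 3)
    + r ^+ 2 * - (r + p *+ 3 + q *+ 3)
    + s ^+ 2 * - (s + t *+ 3) + t ^+ 2 * - (t + s *+ 3) by ring.
by do 5!(apply: in_idealD; last exact: in_idealMr); exact: in_idealMr.
Qed.

(** Eliminating x_4 in the same way leaves cubics in x_0, ..., x_3; the square-free ones are
    products of three variables. *)
Lemma in_ideal_monomial5 m : mdeg m = 3%N -> in_ideal 2 ('X_[m] : {mpoly K[5]}).
Proof.
move=> deg_m; pose x j : {mpoly K[5]} := 'X_(inord j); pose a j := m (inord j).
have Qx j : in_ideal 2 (x j ^+ 2) by apply: in_ideal_varX.
have Ql := @in_ideal_lin 5 2.
rewrite lin_ones5 -/(x 0) -/(x 1) -/(x 2) -/(x 3) -/(x 4) in Ql.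
have -> : 'X_[m] = x 0 ^+ a 0 * x 1 ^+ a 1 * x 2 ^+ a 2 * x 3 ^+ a 3 * x 4 ^+ a 4.
  rewrite mpolyXE_id !big_ord_recl big_ord0 mulr1 !mulrA /x /a.
  do !congr (_ * _); congr ('X_ _ ^+ m _); apply: val_inj; by rewrite /= inordK.
have: (a 0 + a 1 + a 2 + a 3 + a 4 = 3)%N.
  rewrite -[RHS]deg_m mdegE !big_ord_recl big_ord0 addn0 !addnA /a.
  do !congr (_ + _)%N; congr (m _); apply: val_inj; by rewrite /= inordK.
elim: (a 4) (a 0) (a 1) (a 2) (a 3) => [|e IH] a0 a1 a2 a3 deg.
  rewrite expr0 mulr1; rewrite addn0 in deg.
  have Q012 := in_ideal_prod3 (Qx 0) (Qx 1) (Qx 2) (Qx 3) (Qx 4) Ql.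
  have [] : in_ideal 2 (x 0 + x 1 + x 3 + x 2 + x 4) /\
    in_ideal 2 (x 0 + x 2 + x 3 + x 1 + x 4) /\
    in_ideal 2 (x 1 + x 2 + x 3 + x 0 + x 4).
    by split; [|split]; move: Ql; congr in_ideal; ring.
  move=> /(in_ideal_prod3 (Qx 0) (Qx 1) (Qx 3) (Qx 2) (Qx 4)) Q013.
  move=> [/(in_ideal_prod3 (Qx 0) (Qx 2) (Qx 3) (Qx 1) (Qx 4)) Q023].
  move=> /(in_ideal_prod3 (Qx 1) (Qx 2) (Qx 3) (Qx 0) (Qx 4)) Q123.
  have big_exp j b : (2 <= b)%N -> in_ideal 2 (x j ^+ b).
    by move=> /subnK <-; rewrite exprD; apply: in_idealMl.
  case: (leqP 2 a0) => [/big_exp Q | lt0]; first by do 3!apply: in_idealMr; apply: Q.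
  case: (leqP 2 a1) => [/big_exp Q | lt1].
    by do 2!apply: in_idealMr; apply: in_idealMl; apply: Q.
  case: (leqP 2 a2) => [/big_exp Q | lt2]; first by apply: in_idealMr;
    apply: in_idealMl; apply: Q.
  case: (leqP 2 a3) => [/big_exp Q | lt3]; first by apply: in_idealMl; apply: Q.
  move: a0 a1 a2 a3 lt0 lt1 lt2 lt3 deg =>
    [|[|?]] [|[|?]] [|[|?]] [|[|?]] // _ _ _ _ _.
  - by rewrite expr0 mul1r.
  - by rewrite expr0 mulr1.
  - by rewrite expr0 mulr1.
  - by rewrite expr0 mulr1.
set u := x 0 ^+ a0 * x 1 ^+ a1 * x 2 ^+ a2 * x 3 ^+ a3 * x 4 ^+ e.
have -> : x 0 ^+ a0 * x 1 ^+ a1 * x 2 ^+ a2 * x 3 ^+ a3 * x 4 ^+ e.+1 =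
    u * (x 0 + x 1 + x 2 + x 3 + x 4)
    - (x 0 ^+ a0.+1 * x 1 ^+ a1 * x 2 ^+ a2 * x 3 ^+ a3 * x 4 ^+ e
       + x 0 ^+ a0 * x 1 ^+ a1.+1 * x 2 ^+ a2 * x 3 ^+ a3 * x 4 ^+ e
       + x 0 ^+ a0 * x 1 ^+ a1 * x 2 ^+ a2.+1 * x 3 ^+ a3 * x 4 ^+ e
       + x 0 ^+ a0 * x 1 ^+ a1 * x 2 ^+ a2 * x 3 ^+ a3.+1 * x 4 ^+ e).
  by rewrite /u !exprS; ring.
apply: in_idealB; first exact: in_idealMl.
by do 3!(apply: in_idealD; last by apply: IH; lia); apply: IH; lia.
Qed.

Lemma surj_at_4 d k : (1 < d < 5)%N -> (0 < k)%N ->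
  surj_at d k (ones : 'I_4 -> K) (d * k + d.-2).
Proof.
move=> d_bounds /prednK <-; rewrite mulnS -addnA addnCA.
apply: surj_at_pow; first by case/andP: d_bounds.
by apply: surj_at_in_ideal => m; apply: in_ideal_monomial4.
Qed.

Lemma surj_at_5 k : (0 < k)%N -> surj_at 2 k (ones : 'I_5 -> K) (2 * k).
Proof.
move=> /prednK <-; rewrite mulnS addnC; apply: (surj_at_pow (d := 2)) => //.
by apply: surj_at_in_ideal => m; apply: in_ideal_monomial5.
Qed.

End Surjectivity.

(** * Injectivity for squares *)

Section SignedRoots.
Variables (K : numFieldType) (n : nat).
Local Notation ones := ((fun=> 1) : 'I_n.+1 -> K).
Local Notation P := {mpoly K[n.+1]}.

(** [phi] views a polynomial as univariate in x_0; coefficients stay in the domain [P], where the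
    roots also live. *)
Let h (j : 'I_n.+1) : {poly P} := if j == ord0 then 'X else ('X_j)%:P.
Let phi : P -> {poly P} := mmap (polyC \o @mpolyC n.+1 K) h.

Let phi_horner (p r : P) : (phi p).[r] =
  \sum_(m <- msupp p) (p@_m)%:MP * \prod_j (if j == ord0 then r else 'X_j) ^+ m j.
Proof.
rewrite /phi /mmap horner_sum; apply: eq_bigr => m _.
rewrite hornerM hornerC /mmap1 horner_prod; congr (_ * _); apply: eq_bigr => j _.
by rewrite horner_exp /h; case: ifP => _; rewrite ?hornerX ?hornerC.
Qed.

(** Evaluation at x_0 recovers p. *)
Let phi_eq0 p : phi p = 0 -> p = 0.
Proof.
move=> phi0; have := phi_horner p 'X_ord0; rewrite phi0 horner0 => ->.
rewrite [LHS]mpolyE; apply: eq_bigr => m _.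
rewrite mul_mpolyC mpolyXE_id; congr (_ *: _); apply: eq_bigr => j _.
by case: eqP => [->|].
Qed.

Let size_phi p i : p \is i.-homog -> (size (phi p) <= i.+1)%N.
Proof.
move=> pH; rewrite /phi /mmap big_seq; elim/big_ind: _ => [|f g sf sg|m m_p].
- by rewrite size_poly0.
- by rewrite (leq_trans (size_polyD _ _)) // geq_max sf.
rewrite /= mul_polyC (leq_trans (size_scale_leq _ _)) //.
rewrite /mmap1 (bigD1 ord0) //= {1}/h eqxx.
have -> : \prod_(j < n.+1 | j != ord0) h j ^+ m j =
    (\prod_(j < n.+1 | j != ord0) 'X_j ^+ m j)%:P.
  by rewrite rmorph_prod; apply: eq_bigr => j /negPf nj0; rewrite /h nj0 rmorphXn.
rewrite mulrC mul_polyC (leq_trans (size_scale_leq _ _)) // size_polyXn ltnS.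
by rewrite -(dhomog_mf pH m_p) /= mdegE (bigD1 ord0) //= leq_addr.
Qed.

Let root_of (s : {ffun 'I_n -> bool}) : P :=
  - \sum_j (-1) ^+ s j *: 'X_(lift ord0 j).

Let root_of_inj : injective root_of.
Proof.
move=> s t /oppr_inj /(congr1 (fun p : P => p@_U_(lift ord0 _))) st.
apply/ffunP => j; have {st} := st j.
have coefE u : (\sum_l (-1) ^+ (u : {ffun 'I_n -> bool}) l *:
    ('X_(lift ord0 l) : P))@_U_(lift ord0 j) = (-1) ^+ u j.
  rewrite raddf_sum /= (bigD1 j) //= mcoeffZ mcoeffXU eqxx mulr1 big1 ?addr0 // =>
    l nlj.
  by rewrite mcoeffZ mcoeffXU (inj_eq (@lift_inj _ _)) (negPf nlj) mulr0.
rewrite !coefE; case: (s j); case: (t j) => // /eqP.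
  by rewrite expr1 expr0 eqNr oner_eq0.
by rewrite expr1 expr0 eq_sym eqNr oner_eq0.
Qed.

(* A multiple of x_0 + ... + x_n that is even in every variable vanishes, as a
   polynomial in x_0, at the 2^n points - (+- x_1 +- ... +- x_n). *)
Lemma inj_at_2 k : (0 < k)%N -> (2 * k < 2 ^ n)%N -> inj_at 2 k ones (2 * k).-1.
Proof.
move=> k_gt0 lt_k g gH Ig; pose f := lin ones * g.
have fH : f \is (2 * k).-homog.
  have -> : (2 * k = 1 + (2 * k).-1)%N by lia.
  by apply: dhomogM => //; exact: lin_homog.
(* Degree 2k and level at least k leave no room for an odd exponent. *)
have even_f m : m \in msupp f -> forall j, m j = (2 * (m j %/ 2))%N.
  move=> m_f; have deg_m := dhomog_mf fH m_f.
  have le_k : (k <= level 2 m)%N.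
    by rewrite leqNgt; apply/negP => /Ig /eqP; rewrite mcoeff_eq0 m_f.
  have le_j j : (2 * (m j %/ 2) <= m j)%N by rewrite mulnC leq_divM.
  have : (\sum_j 2 * (m j %/ 2) == \sum_j m j)%N.
    rewrite eqn_leq leq_sum //= -big_distrr /= -/(level 2 m) -mdegE.
    by move: deg_m le_k; rewrite /= => ->; lia.
  rewrite (leqif_sum (fun j _ => leqif_eq (le_j j))) => /forallP eq_m j.
  by have /eqP := eq_m j.
have root_f s : root (phi f) (root_of s).
  (* This substitution sends x_0 to the root and changes signs of other variables: it kills
     [lin ones], and the even polynomial f does not see the signs. *)
  pose v j : P := if unlift ord0 j is Some l then (-1) ^+ s l *: 'X_j else root_of s.
  have lin0 : mmap (@mpolyC n.+1 K) v (lin ones) = 0.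
    rewrite /lin raddf_sum /=; under eq_bigr do rewrite mmapZ mmapX mmap1U mul1r.
    rewrite big_ord_recl /v unlift_none /root_of; apply/eqP; rewrite addrC subr_eq0.
    by apply/eqP; apply: eq_bigr => j _; rewrite liftK.
  have := rmorphM (mmap (@mpolyC n.+1 K) v) (lin ones) g; rewrite /= lin0 mul0r.
  rewrite /root phi_horner => f0;
    rewrite -[X in _ == X]f0 -/f /mmap big_seq [X in _ == X]big_seq.
  apply/eqP; apply: eq_bigr => m m_f; congr (_ * _); apply: eq_bigr => j _.
  rewrite /v; case: unliftP => [l ->|->]; last by rewrite eqxx.
  rewrite eq_sym (negPf (neq_lift _ _)) (even_f m m_f) !exprM exprZn.
  by rewrite sqrr_sign scale1r.
have f0 : f = 0.
  apply/phi_eq0/eqP; apply: contraLR lt_k => nz_phi.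
  have := max_poly_roots nz_phi (rs := [seq root_of s | s <- enum {ffun 'I_n ->
    bool}]).
  rewrite (map_inj_uniq root_of_inj) enum_uniq size_map -cardE card_ffun card_bool
    card_ord.
  move=> lt_size; rewrite -leqNgt -ltnS (leq_trans _ (size_phi fH)) ?lt_size //.
  by apply/allP => _ /mapP[s _ ->].
move/eqP: f0; rewrite mulf_eq0 => /orP[|/eqP ->]; last exact: in_pow_zero.
move/eqP/(congr1 (fun p : P => p@_U_(ord0))); rewrite mcoeff0 /lin raddf_sum /=.
rewrite (bigD1 ord0) //= scale1r mcoeffXU eqxx big1 ?addr0 => [/eqP|j /negPf nj0].
  by rewrite oner_eq0.
by rewrite scale1r mcoeffXU nj0.
Qed.

End SignedRoots.

(** * Injectivity for cubes and fourth powers *)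

Section Elimination.

Definition zhead (r : seq Z) : Z := head Z0 r.

(** Missing entries count as 0, as in the empty rows made by [cancel_head]. *)
Fixpoint zcomb (a b : Z) (r p : seq Z) : seq Z :=
  match r, p with
  | [::], _ => [seq Z.opp (Z.mul b y) | y <- p]
  | _, [::] => [seq Z.mul a x | x <- r]
  | x :: r', y :: p' => Z.sub (Z.mul a x) (Z.mul b y) :: zcomb a b r' p'
  end.

(* The test spares a proof that the leading entries cancel; the empty row stands
   for the trivial equation. *)
Definition cancel_head (p r : seq Z) : seq Z :=
  let g := Z.gcd (zhead p) (zhead r) in
  let a := Z.div (zhead p) g in let b := Z.div (zhead r) g in
  if Z.eqb (Z.mul a (zhead r)) (Z.mul b (zhead p)) then zcomb a b (behead r)
    (behead p) else [::].

(** Fraction-free Gaussian elimination: each column must have a pivot row, which clears that column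
    in the other rows. *)
Fixpoint full_rank (n : nat) (rows : seq (seq Z)) : bool :=
  match n with
  | 0 => true
  | n'.+1 =>
    match [seq r <- rows | ~~ Z.eqb (zhead r) Z0] with
    | [::] => false
    | p :: ps => full_rank n' ([seq cancel_head p r | r <- ps]
                  ++ [seq behead r | r <- rows & Z.eqb (zhead r) Z0])
    end
  end.

Variable K : numFieldType.

Definition zval (z : Z) : K := (int_of_Z z)%:~R.

Lemma zvalM a b : zval (Z.mul a b) = zval a * zval b.
Proof. by rewrite /zval (rmorphM int_of_Z) intrM. Qed.

Lemma zvalN a : zval (Z.opp a) = - zval a.
Proof. by rewrite /zval (rmorphN int_of_Z) intrN. Qed.

Lemma zvalB a b : zval (Z.sub a b) = zval a - zval b.
Proof. by rewrite /zval (rmorphB int_of_Z) intrB. Qed.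

Lemma zval_eq0 a : (zval a == 0) = Z.eqb a Z0.
Proof.
rewrite /zval intr_eq0; apply/eqP/Z.eqb_spec => [a0|->//].
by rewrite -[a]int_of_ZK a0.
Qed.

Fixpoint zdot (r : seq Z) (v : seq K) : K :=
  match r, v with
  | z :: r', x :: v' => zval z * x + zdot r' v'
  | _, _ => 0
  end.

Lemma zdot_comb a b r p v : zdot (zcomb a b r p) v = zval a * zdot r v - zval b *
  zdot p v.
Proof.
elim: v r p => [|w v IH] [|x r] [|y p] //=; rewrite ?mulr0 ?subr0 ?sub0r //.
- have {IH} := IH [::] p; rewrite /= mulr0 sub0r; case: p => [|z p] /= ->.
    by rewrite zvalN zvalM; ring.
  by rewrite zvalN zvalM; ring.
- have {IH} := IH r [::]; rewrite /= mulr0 subr0; case: r => [|z r] /= ->.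
    by rewrite zvalM; ring.
  by rewrite zvalM; ring.
by rewrite IH zvalB !zvalM; ring.
Qed.

Lemma zdot_cons r x v : zdot r (x :: v) = zval (zhead r) * x + zdot (behead r) v.
Proof. by case: r => //=; rewrite /zval mul0r addr0. Qed.

Lemma full_rankP n rows v : full_rank n rows -> size v = n ->
  (forall r, r \in rows -> zdot r v = 0) -> forall x, x \in v -> x = 0.
Proof.
elim: n rows v => [|n IH] rows [|x v] //=.
case def_nz: [seq r <- rows | _] => [|p ps] // fr [sz_v] rows0.
have nz_rows r : r \in p :: ps -> (r \in rows) && ~~ Z.eqb (zhead r) Z0.
  by rewrite -def_nz mem_filter andbC.
have /andP[p_rows nz_p] := nz_rows p (mem_head _ _).
have p0 := rows0 p p_rows; rewrite zdot_cons in p0.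
have v0 : forall y, y \in v -> y = 0.
  apply: IH fr sz_v _ => r; rewrite mem_cat => /orP[] /mapP[r' r'_in ->].
    have /andP[r'_rows _] : (r' \in rows) && ~~ Z.eqb (zhead r') Z0.
      by apply: nz_rows; rewrite inE r'_in orbT.
    have r'0 := rows0 r' r'_rows; rewrite zdot_cons in r'0.
    rewrite /cancel_head; case: Z.eqb_spec => // /(congr1 zval).
    rewrite !zvalM zdot_comb => ab.
    have -> : zdot (behead r') v = - (zval (zhead r') * x).
      by apply/eqP; rewrite -addr_eq0 addrC r'0.
    have -> : zdot (behead p) v = - (zval (zhead p) * x).
      by apply/eqP; rewrite -addr_eq0 addrC p0.
    by rewrite !mulrN !mulrA ab subrr.
  move: r'_in; rewrite mem_filter => /andP[/Z.eqb_spec r'_hd r'_rows].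
  by have := rows0 r' r'_rows; rewrite zdot_cons r'_hd mul0r add0r.
have dot0 r : zdot r v = 0.
  elim: r (v) v0 => [|z r IHr] [|y w] //= w0; rewrite IHr => [|u u_w].
    by rewrite (w0 y (mem_head _ _)) mulr0 addr0.
  by apply: w0; rewrite inE u_w orbT.
move=> y; rewrite inE => /orP[/eqP ->|]; last exact: v0.
(* With a zero tail, the pivot row reads [zhead p] times x = 0. *)
move/eqP: p0; rewrite dot0 addr0 mulf_eq0 zval_eq0 (negPf nz_p) /=.
by move/eqP.
Qed.

End Elimination.

(** * The multiplication matrix on standard monomials *)

Section MonomialLists.

Fixpoint exponents (n s : nat) : seq (seq nat) :=
  match n with
  | 0 => if s == 0%N then [:: [::]] else [::]
  | n'.+1 => flatten [seq [seq x :: t | t <- exponents n' (s - x)] | x <- iota 0 s.+1]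
  end.

Lemma exponentsS n s : exponents n.+1 s =
  flatten [seq [seq x :: t | t <- exponents n (s - x)] | x <- iota 0 s.+1].
Proof. by []. Qed.

Lemma exponentsP n s a : (a \in exponents n s) = (size a == n) && (sumn a == s).
Proof.
elim: n s a => [|n IH] s a.
  by case: a => [|x a]; case: s.
rewrite exponentsS; apply/flatten_mapP/idP => [[x] | ].
  rewrite mem_iota add0n ltnS => /= le_x /mapP[t];
    rewrite IH => /andP[/eqP sz /eqP sm] ->.
  by rewrite /= sz sm subnKC ?eqxx.
case: a => // x a /andP[/eqP[sz] /eqP sm]; rewrite [sumn _]/= in sm; exists x.
  by rewrite mem_iota /=; lia.
by apply: map_f; rewrite IH sz eqxx /=; apply/eqP; lia.
Qed.

Lemma exponents_uniq n s : uniq (exponents n s).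
Proof.
elim: n s => [|n IH] s; first by rewrite /=; case: ifP.
rewrite exponentsS; apply: allpairs_uniq_dep => [|x _|];
  [exact: iota_uniq | exact: IH |].
by move=> [x t] [y u] _ _ /= [-> ->].
Qed.

Definition std_exponents (n d k i : nat) :=
  [seq a <- exponents n i | (sumn [seq (x %/ d)%N | x <- a] < k)%N].

Definition decr (b : seq nat) (j : nat) := set_nth 0%N b j (nth 0%N b j).-1.

Definition decrs (n : nat) (b : seq nat) :=
  [seq decr b j | j <- iota 0 n & nth 0%N b j != 0%N].

(* Eliminating first the monomials with a large exponent keeps the entries that
   appear during the elimination small. *)
Definition unknowns (n d k i : nat) :=
  sort (fun a b : seq nat => foldr maxn 0 b <= foldr maxn 0 a)%N
    (std_exponents n d k i).

(* One row for each standard monomial b of degree i + 1: the coefficient of x^b in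
   (x_1 + ... + x_n) f is the sum of the coefficients of f at b - e_j. *)
Definition mult_rows (n d k i : nat) : seq (seq Z) :=
  let U := unknowns n d k i in
  [seq let D := decrs n b in [seq Z.of_nat (count_mem a D) | a <- U]
     | b <- std_exponents n d k i.+1].

Definition inj_check (n d k i : nat) : bool :=
  full_rank (size (unknowns n d k i)) (mult_rows n d k i).

Variables (K : numFieldType) (n d : nat).

Let mon (a : seq nat) : 'X_{1..n} := [multinom nth 0%N a j | j < n].

(** The coefficients of f at the standard monomials of degree i solve the system [mult_rows]. *)
Lemma inj_checkP k i : inj_check n d k i -> inj_at d k ((fun=> 1) : 'I_n -> K) i.
Proof.
move=> fr f fH If m lt_m.
have [deg_m | deg_m] := eqVneq (mdeg m) i; last exact: dhomog_nemf_coeff fH deg_m.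
pose U := unknowns n d k i; pose c (a : seq nat) := f@_(mon a).
have Uuniq : uniq U by rewrite sort_uniq; apply: filter_uniq; apply: exponents_uniq.
have level_mon a : size a = n -> level d (mon a) = sumn [seq (x %/ d)%N | x <- a].
  move=> sz_a; rewrite /level sumnE big_map (big_nth 0%N) big_mkord sz_a.
  by apply: eq_bigr => j _; rewrite mnmE.
have mdeg_mon a : size a = n -> mdeg (mon a) = sumn a.
  move=> sz_a; rewrite mdegE sumnE (big_nth 0%N) big_mkord sz_a.
  by apply: eq_bigr => j _; rewrite mnmE.
have monK (m' : 'X_{1..n}) : mon m' = m'.
  by apply/mnmP => j; rewrite mnmE -mnm_nth.
have stdP (m' : 'X_{1..n}) l : (level d m' < k)%N -> mdeg m' = l ->
    (m' : seq nat) \in std_exponents n d k l.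
  move=> lt_m' deg_m'; rewrite mem_filter exponentsP size_tuple eqxx /=.
  by rewrite -level_mon ?size_tuple // monK lt_m' -mdeg_mon ?size_tuple // monK
    deg_m' eqxx.
have m_U : (m : seq nat) \in U by rewrite mem_sort; apply: stdP.
suff : c m = 0 by rewrite /c monK.
apply: (full_rankP fr (v := map c U));
  rewrite ?size_map // ?map_f // => _ /mapP[b b_in ->].
rewrite -/U; move: b_in;
  rewrite mem_filter exponentsP => /and3P[lt_b /eqP sz_b /eqP sm_b].
pose D := decrs n b; rewrite -/D.
have mon_decr j : (j : nat) \in iota 0 n -> nth 0%N b j != 0%N ->
    size (decr b j) = n /\ forall jn : 'I_n, jn = j :> nat ->
      mon (decr b j) = (mon b - U_(jn))%MM.
  rewrite mem_iota /= => lt_j nz_bj; split.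
    by rewrite size_set_nth sz_b; apply/maxn_idPr.
  move=> jn def_j; apply/mnmP => l; rewrite mnmBE !mnmE nth_set_nth /= -def_j.
  by rewrite val_eqE eq_sym; case: eqP => [->|_]; rewrite ?subn1 ?subn0.
(* A divisor of a standard monomial is standard, so each row involves only the unknowns. *)
have DU a : a \in D -> a \in U.
  move=> /mapP[j]; rewrite mem_filter => /andP[nz_bj j_in] ->.
  have [sz_d /(_ (Ordinal (_ : j < n)%N)) mon_d] := mon_decr j j_in nz_bj.
  have lt_j : (j < n)%N by move: j_in; rewrite mem_iota.
  have {}mon_d := mon_d lt_j erefl.
  have def_b : (mon b - U_(Ordinal lt_j) + U_(Ordinal lt_j))%MM = mon b.
    by apply: submK; rewrite lep1mP mnmE.
  rewrite mem_sort mem_filter exponentsP sz_d eqxx -level_mon // mon_d.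
  rewrite (leq_ltn_trans (level_le d (lem_subr _ _))) ?level_mon //=.
  rewrite -mdeg_mon // mon_d; apply/eqP; have := congr1 mdeg def_b.
  by rewrite mdegD mdeg1 mdeg_mon // sm_b; lia.
have dotE (s : seq (seq nat)) : zdot [seq Z.of_nat (count_mem a D) | a <- s] (map c
  s) =
    \sum_(a <- s) c a *+ count_mem a D.
  elim: s => [|a s IH]; first by rewrite big_nil.
  rewrite big_cons /= IH; congr (_ + _).
  by rewrite /zval -[Z.of_nat _]/(Z_of_int (Posz _)) Z_of_intK mulr_natl.
have sumE (E : seq (seq nat)) : (forall a, a \in E -> a \in U) ->
    \sum_(a <- U) c a *+ count_mem a E = \sum_(a <- E) c a.
  elim: E => [|a E IH] EU; first by rewrite big1 ?big_nil.
  rewrite big_cons -IH => [|a' a'_E]; last by apply: EU; rewrite inE a'_E orbT.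
  under eq_bigr do rewrite /= mulrnDr; rewrite big_split /=; congr (_ + _).
  rewrite (bigD1_seq a) ?EU ?mem_head //= eqxx mulr1n big1 ?addr0 // =>
    a' /negPf naa'.
  by rewrite eq_sym naa' mulr0n.
rewrite dotE sumE //.
have := If (mon b); rewrite level_mon // lt_b => /(_ isT); rewrite mcoeff_lin => sum0.
have iotaE : iota 0 n = index_iota 0 n by rewrite /index_iota subn0.
rewrite -[RHS]sum0 /D big_map big_filter iotaE big_mkord big_mkcond /=.
apply: eq_bigr => j _; rewrite mnmE; case: eqP => //= /eqP nz_bj.
have j_in : (j : nat) \in iota 0 n by rewrite mem_iota /=.
by have [_ /(_ j erefl) mon_d] := mon_decr j j_in nz_bj; rewrite /c mon_d mul1r.
Qed.

End MonomialLists.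

(** For k = 2 the critical degree dk + d - 3 is 6 when d = 3 and 9 when d = 4. *)
Lemma inj_check_4_3 : inj_check 4 3 2 6. Proof. by vm_compute. Qed.
Lemma inj_check_4_4 : inj_check 4 4 2 9. Proof. by vm_compute. Qed.

(** * The weak Lefschetz property *)

(** Degrees up to i0 inherit injectivity, provided i0 is at most the socle degree; higher ones
    inherit surjectivity. *)
Lemma wlp_holds (K : numFieldType) n d k i0 (d_gt0 : (0 < d)%N) (k_gt0 : (0 < k)%N) :
  (0 < n)%N -> (i0 <= d * k.-1 + n * d.-1)%N ->
  inj_at d k ((fun=> 1) : 'I_n -> K) i0 -> surj_at d k ((fun=> 1) : 'I_n ->
    K) i0.+1 ->
  weak_lefschetz (power_quot_gr K n d k d_gt0 k_gt0).
Proof.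
move=> n_gt0 le_i0 inj surj; apply/weak_lefschetzP; exists (fun=> 1) => i.
case: (leqP i i0) => le_i; [left | right].
  exact: inj_at_le le_i0 inj.
exact: surj_at_le surj.
Qed.

(** Powers of x_1^d carry the kernel element from k0 to k, into degree dk + d - 3, where no linear
    form is surjective; [inj_at_ones] extends the failure of injectivity to every form. *)
Lemma wlp_fails (K : numFieldType) n d k0 k i (d_gt0 : (0 < d)%N) (k_gt0 : (0 <
  k)%N) :
  (0 < k0 <= k)%N -> (i.+1 = (d * k0).-1 + d.-1)%N ->
  ~ inj_at d k0 ((fun=> 1) : 'I_n.+4 -> K) i ->
  ~ weak_lefschetz (power_quot_gr K n.+4 d k d_gt0 k_gt0).
Proof.
case/andP=> k0_gt0 le_k def_i ninj /weak_lefschetzP[c wl].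
have [/inj_at_ones|] := wl (d * (k - k0) + i)%N.
  exact: (not_inj_at_le d_gt0 le_k ninj).
apply: not_surj_at => //; rewrite -addnS def_i -[in RHS](subnKC le_k) mulnDr.
have : (0 < d * k0)%N by rewrite muln_gt0 d_gt0.
by lia.
Qed.

Theorem theorem21 (R : realType) (k : nat) (k_gt0 : (0 < k)%N) :
  [/\ weak_lefschetz (power_quot_gr R[i] 4 2 k isT k_gt0)
        <-> (k <= 3)%N,
      weak_lefschetz (power_quot_gr R[i] 4 3 k isT k_gt0)
        <-> (k <= 2)%N,
      weak_lefschetz (power_quot_gr R[i] 4 4 k isT k_gt0)
        <-> (k <= 2)%N &
      weak_lefschetz (power_quot_gr R[i] 5 2 k isT k_gt0)
        <-> (k <= 7)%N].
Proof.
have fails n d k0 i (d_gt0 : (0 < d)%N) : (i.+1 = (d * k0.+1).-1 + d.-1)%N ->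
    ~ inj_at d k0.+1 ((fun=> 1) : 'I_n.+4 -> R[i]) i ->
    weak_lefschetz (power_quot_gr R[i] n.+4 d k d_gt0 k_gt0) -> (k <= k0)%N.
  move=> def_i ninj wl; rewrite leqNgt; apply/negP => lt_k.
  by apply: (@wlp_fails R[i] n d k0.+1 k i) wl; rewrite ?lt_k.
have k12 : (k <= 2)%N -> k = 1%N \/ k = 2%N by lia.
split; split=> [wl | le_k].
- exact: (fails 0 2 3 7 isT erefl (@not_inj_4_2 _) wl).
- apply: (@wlp_holds _ _ _ _ (2 * k).-1) => //; first by lia.
    (* In four variables the condition is 2k < 2^3. *)
    by apply: inj_at_2 => //; lia.
  have := @surj_at_4 R[i] 2 k isT k_gt0; rewrite addn0 prednK //; lia.
- exact: (fails 0 3 2 9 isT erefl (@not_inj_4_3 _) wl).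
- apply: (@wlp_holds _ _ _ _ (3 * k)) => //; first by lia.
    (* The computation is done for k = 2; multiplication by x_1^d gives k = 1. *)
    have inj2 := inj_checkP (K := R[i]) inj_check_4_3.
    by have [def_k|def_k] := k12 le_k; rewrite def_k //;
      apply: (@inj_at_shift 4 3) inj2.
  by have := @surj_at_4 R[i] 3 k isT k_gt0; rewrite addn1.
- exact: (fails 0 4 2 13 isT erefl (@not_inj_4_4 _) wl).
- apply: (@wlp_holds _ _ _ _ (4 * k).+1) => //; first by lia.
    have inj2 := inj_checkP (K := R[i]) inj_check_4_4.
    by have [def_k|def_k] := k12 le_k; rewrite def_k //;
      apply: (@inj_at_shift 4 4) inj2.
  by have := @surj_at_4 R[i] 4 k isT k_gt0; rewrite addn2.
- exact: (fails 1 2 7 15 isT erefl (@not_inj_5_2 _) wl).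
apply: (@wlp_holds _ _ _ _ (2 * k).-1) => //; first by lia.
  by apply: inj_at_2 => //; rewrite (_ : 2 ^ 4 = 16)%N //; lia.
have := @surj_at_5 R[i] k k_gt0; rewrite prednK //; lia.
Qed.
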